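(* Let $b\in H^\infty_1$. Then $X_b$ is not reducible.
   Context: $H^2$ is the Hardy space of the unit disk, viewed as a closed subspace of $L^2=L^2(\mathbb{T})$, $P:L^2\to H^2$ the orthogonal projection, $T_f h=P(fh)$ the Toeplitz operator on $H^2$ with symbol $f\in L^\infty(\mathbb{T})$, $S=T_z$ and $S^*=T_{\bar z}$ the backward shift. $H^\infty$ is the space of bounded analytic functions on the unit disk and $H^\infty_1$ its closed unit ball. For a bounded operator $A$ on a Hilbert space $H$, the range space $\mathcal{M}(A)=AH$ carries the inner product $\langle Af,Ag\rangle_{\mathcal{M}(A)}=\langle f,g\rangle_H$ for $f,g\in H\ominus\ker A$. For $b\in H^\infty_1$, the de Branges-Rovnyak space is $\mathcal{H}(b)=\mathcal{M}((I-T_bT_{\bar b})^{1/2})$, with $A=(I-T_bT_{\bar b})^{1/2}$ acting on $H^2$. It is invariant under $S^*$, and $X_b=S^*|_{\mathcal{H}(b)}$ is a contraction on $\mathcal{H}(b)$. A closed subspace $M$ of a Hilbert space is a reducing subspace of a bounded operator $T$ if $TM\subset M$ and $T^*M\subset M$; $T$ is reducible if it has a reducing subspace other than $\{0\}$ and the whole space. *)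

(* Defs.v *)
From HB Require Import structures.
From mathcomp Require Import all_boot all_order all_algebra.
From mathcomp Require Import generic_quotient ring_quotient.
From mathcomp Require Import all_classical all_reals all_analysis.
From mathcomp Require Import complex.

Set Implicit Arguments.
Unset Strict Implicit.
Unset Printing Implicit Defensive.

Import Order.TTheory GRing.Theory Num.Theory.
Import numFieldNormedType.Exports.

Local Open Scope classical_set_scope.
Local Open Scope complex_scope.
Local Open Scope ring_scope.

(** * Inner product spaces inside an ambient vector space, and operators

    A space is a carrier set in an ambient vector space [V] together with its
    own inner product, linear in the first argument.  This accommodates a
    range space, which is a subset of the original space with another inner
    product.  An operator on [E] is a total function [V -> V] of which only
    the values on [E] are meaningful. *)

Record ipspace (R : realType) (V : lmodType R[i]) := IPSpace {
  carrier : set V;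
  ip : V -> V -> R[i]
}.

Section Operators.
Context (R : realType) (V : lmodType R[i]).
Implicit Types (E : ipspace V) (A B T : V -> V) (M : set V) (x y z : V).

Definition ipnorm E x : R := Num.sqrt (complex.Re (ip E x x)).

Definition bounded_op E T : Prop :=
  [/\ (forall x, carrier E x -> carrier E (T x)),
      (forall (a : R[i]) x y, carrier E x -> carrier E y -> T (a *: x + y) = a *: T x + T y) &
      exists c : R, forall x, carrier E x -> ipnorm E (T x) <= c * ipnorm E x].

(* The order on [R[i]] makes [0 <= w] say that [w] is real and nonnegative. *)
Definition positive_op E T : Prop :=
  bounded_op E T /\ forall x, carrier E x -> 0 <= ip E (T x) x.

(* The choice operator [xget] picks an element of a set and returns its first
   argument when the set is empty; the sets below have exactly one element in
   all the cases of interest (up to the values outside [E] for [op_sqrt]). *)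
Definition op_sqrt E B : V -> V :=
  xget (fun=> 0) [set A | positive_op E A /\ forall x, carrier E x -> A (A x) = B x].

Definition adjoint E T : V -> V := fun x =>
  xget 0 [set y | carrier E y /\ forall z, carrier E z -> ip E (T z) x = ip E z y].

Definition orth_proj E M : V -> V := fun x =>
  xget 0 [set y | M y /\ forall z, M z -> ip E (x - y) z = 0].

Definition op_ker E A : set V := [set x | carrier E x /\ A x = 0].

Definition coimage E A : set V :=
  [set f | carrier E f /\ forall g, op_ker E A g -> ip E f g = 0].

Definition coimage_lift E A : V -> V := fun x =>
  xget 0 [set f | coimage E A f /\ A f = x].

Definition range_space E A : ipspace V := {|
  carrier := A @` carrier E;
  ip := fun x y => ip E (coimage_lift E A x) (coimage_lift E A y)
|}.

Definition closed_subspace E M : Prop :=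
  [/\ M `<=` carrier E,
      M 0,
      (forall (a : R[i]) x y, M x -> M y -> M (a *: x + y)) &
      forall (u : nat -> V) x, (forall n, M (u n)) -> carrier E x ->
        (ipnorm E (u n - x) @[n --> \oo] --> (0 : R)) -> M x].

Definition reducing_subspace E T M : Prop :=
  [/\ closed_subspace E M, T @` M `<=` M & adjoint E T @` M `<=` M].

Definition reducible E T : Prop :=
  exists M : set V,
    [/\ reducing_subspace E T M, M <> [set 0] & M <> carrier E].

End Operators.

(** * The space of classes of square-integrable complex functions *)

Section ComplexL2.
Context d (T : measurableType d) (R : realType).
Variable mu : {measure set T -> \bar R}.

Definition cmeasurable (f : T -> R[i]) : Prop :=
  measurable_fun setT (@complex.Re R \o f) /\ measurable_fun setT (@complex.Im R \o f).

Definition cintegral (f : T -> R[i]) : R[i] :=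
  (\int[mu]_(t in setT) complex.Re (f t)) +i* (\int[mu]_(t in setT) complex.Im (f t)).

(* Square integrability of [f] amounts to that of its real and imaginary
   parts, as |f|^2 = (Re f)^2 + (Im f)^2. *)
Definition Lfun2C : {pred T -> R[i]} := fun f =>
  ((@complex.Re R \o f) \in Lfun mu 2%:E) && ((@complex.Im R \o f) \in Lfun mu 2%:E).

Lemma Lfun2C_submod_closed : submod_closed Lfun2C.
Proof.
have h1 : (1 <= 2%:E :> \bar R)%E by rewrite lee_fin ler1n.
have cl := Lfun_submod_closed mu h1.
have c0 : (0 : T -> R) \in Lfun mu 2%:E by case: cl.
have cD (a : R) (f g : T -> R) : f \in Lfun mu 2%:E -> g \in Lfun mu 2%:E ->
    a *: f + g \in Lfun mu 2%:E by case: cl => _; apply.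
split; first by apply/andP; split; exact: c0.
move=> a f g /andP[f1 f2] /andP[g1 g2].
pose re (h : T -> R[i]) : T -> R := @complex.Re R \o h.
pose im (h : T -> R[i]) : T -> R := @complex.Im R \o h.
apply/andP; split.
- have -> : @complex.Re R \o (a *: f + g) =
      complex.Re a *: re f + ((- complex.Im a) *: im f + re g).
    apply/funext => t; rewrite /re /im /= !fctE /=.
    by case: a => a1 a2; case: (f t) => x y; case: (g t) => z w /=;
      rewrite addrA scaleNr.
  by apply: (cD) => //; exact: cD.
- have -> : @complex.Im R \o (a *: f + g) =
      complex.Re a *: im f + (complex.Im a *: re f + im g).
    apply/funext => t; rewrite /re /im /= !fctE /=.
    by case: a => a1 a2; case: (f t) => x y; case: (g t) => z w /=;
      rewrite addrA.
  by apply: (cD) => //; exact: cD.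
Qed.

HB.instance Definition _ :=
  GRing.isSubmodClosed.Build R[i] (T -> R[i]) Lfun2C Lfun2C_submod_closed.

Record Lfun2CType := MkLfun2C {
  Lfun2C_val :> T -> R[i];
  Lfun2C_valP : Lfun2C_val \in Lfun2C
}.
HB.instance Definition _ := [isSub for Lfun2C_val].
HB.instance Definition _ := [Choice of Lfun2CType by <:].
HB.instance Definition _ := [SubChoice_isSubLmodule of Lfun2CType by <:].

Definition null2C : {pred Lfun2CType} := fun f =>
  `[< {ae mu, forall t, (f : T -> R[i]) t = 0} >].

Lemma null2C_scale (a : R[i]) (f : Lfun2CType) : f \in null2C -> a *: f \in null2C.
Proof.
move=> /asboolP h; apply/asboolP; apply: filterS h => t h.
by rewrite /= fctE h scaler0.
Qed.

Lemma null2C_zmod_closed : zmod_closed null2C.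
Proof.
split; first by apply/asboolP; exact: aeW.
move=> f g /asboolP hf /asboolP hg; apply/asboolP.
apply: filterS2 hf hg => t hf hg.
by change (Lfun2C_val f t - Lfun2C_val g t = 0); rewrite hf hg subrr.
Qed.

HB.instance Definition _ :=
  GRing.isZmodClosed.Build Lfun2CType null2C null2C_zmod_closed.

Definition L2C : Type := Quotient.quot null2C.
HB.instance Definition _ := GRing.Zmodule.on L2C.
HB.instance Definition _ := EqQuotient.on L2C.

Local Open Scope quotient_scope.

Definition L2C_scale (a : R[i]) (x : L2C) : L2C := \pi_L2C (a *: repr x).

Lemma L2C_scaleE (a : R[i]) (f : Lfun2CType) :
  L2C_scale a (\pi_L2C f) = \pi_L2C (a *: f).
Proof.
apply/eqP; rewrite -Quotient.idealrBE -scalerBr; apply: null2C_scale.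
by rewrite Quotient.idealrBE reprK.
Qed.

Let L2C_scaleA (a b : R[i]) (x : L2C) :
  L2C_scale a (L2C_scale b x) = L2C_scale (a * b) x.
Proof. by elim/quotW: x => f; rewrite (L2C_scaleE b f) !L2C_scaleE scalerA. Qed.

Let L2C_scale1 : left_id 1 L2C_scale.
Proof. by elim/quotW=> f; rewrite L2C_scaleE scale1r. Qed.

Let pi_L2CD (f g : Lfun2CType) : \pi_L2C (f + g) = \pi_L2C f + \pi_L2C g :> L2C.
Proof. exact: Quotient.pi_add. Qed.

Let L2C_scaleDr : right_distributive L2C_scale +%R.
Proof.
move=> a; elim/quotW=> f; elim/quotW=> g.
rewrite -pi_L2CD !L2C_scaleE scalerDr.
exact: pi_L2CD.
Qed.

Let L2C_scaleDl (x : L2C) :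
  {morph L2C_scale^~ x : a b / a + b}.
Proof.
by elim/quotW: x => f a b; rewrite !L2C_scaleE scalerDl; exact: pi_L2CD.
Qed.

HB.instance Definition _ := GRing.Zmodule_isLmodule.Build R[i] L2C
  L2C_scaleA L2C_scale1 L2C_scaleDr L2C_scaleDl.

Definition L2C_fun (x : L2C) : T -> R[i] := Lfun2C_val (repr x).

(* The class of a function; 0 when the function is not square-integrable. *)
Definition L2C_class (f : T -> R[i]) : L2C :=
  \pi_L2C (insubd (0 : Lfun2CType) f).

Definition L2C_ip (x y : L2C) : R[i] :=
  cintegral (fun t => L2C_fun x t * (L2C_fun y t)^*%C).

Definition L2C_space : ipspace L2C := {| carrier := setT; ip := L2C_ip |}.

End ComplexL2.

(** * The Hardy space and Toeplitz operators

    The unit circle is parametrized by t in [0, 2 pi], with the normalized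
    arc length dt / (2 pi). *)

Section Hardy.
Context (R : realType).
Implicit Types (b : R[i] -> R[i]) (phi : R -> R[i]).

Lemma twopi_gt0 : (0 : R) < 2 * pi.
Proof. by rewrite mulr_gt0// pi_gt0. Qed.

Definition arc := uniform_prob twopi_gt0.

Definition L2 := L2C arc.

Definition cis (t : R) : R[i] := cos t +i* sin t.

(* Functions in L^2 whose Fourier coefficients of negative index vanish. *)
Definition H2 : ipspace L2 := {|
  carrier := [set x | forall n : nat, (0 < n)%N ->
    cintegral arc (fun t => L2C_fun x t * cis t ^+ n) = 0];
  ip := @L2C_ip _ _ _ arc
|}.

Definition toeplitz phi : L2 -> L2 := fun h =>
  orth_proj (L2C_space arc) (carrier H2)
    (L2C_class arc (fun t => phi t * L2C_fun h t)).

Definition backward_shift : L2 -> L2 := toeplitz (fun t => (cis t)^*%C).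

(* Analyticity: on every disk contained in the unit disk, the function is the
   sum of a power series about the center of that disk. *)
Definition analytic_unit_disk b : Prop :=
  forall (w : R[i]) (rho : R), 0 < rho ->
    (forall z : R[i], `|z - w| < rho%:C -> `|z| < 1) ->
    exists a : nat -> R[i], forall z : R[i], `|z - w| < rho%:C ->
      \sum_(k < n) a k * (z - w) ^+ k @[n --> \oo] --> (b z : R[i]^o).

Definition Hinf_ball b : Prop :=
  analytic_unit_disk b /\ forall z : R[i], `|z| < 1 -> `|b z| <= 1.

(* The function on the circle given by the radial limits of [b]; by Fatou's
   theorem it exists, and is unique up to a null set, for bounded analytic
   [b]. *)
Definition boundary b : R -> R[i] :=
  xget (fun=> 0) [set phi | cmeasurable phi /\
    {ae arc, forall t : R,
      b (r%:C * cis t) @[r --> (1 : R)^'-] --> (phi t : R[i]^o)}].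

Definition defect b : L2 -> L2 := fun h =>
  h - toeplitz (boundary b) (toeplitz (fun t => (boundary b t)^*%C) h).

Definition deBrangesRovnyak b : ipspace L2 :=
  range_space H2 (op_sqrt H2 (defect b)).

Definition Xb b : L2 -> L2 :=
  patch (fun=> 0) (carrier (deBrangesRovnyak b)) backward_shift.

End Hardy.

(* Main.v *)
Require Import Defs.
From mathcomp Require Import all_boot all_order all_algebra.
From mathcomp Require Import generic_quotient ring_quotient.
From mathcomp Require Import all_classical all_reals all_analysis.
From mathcomp Require Import measurable_realfun.
From mathcomp Require Import complex.
From mathcomp Require Import ring lra.

(** Write [T] for multiplication by [b] on [H^2], [S] for the shift, [S^*] for the
backward shift, [A] for the square root of [I - T T^*], and [<., .>_b] for the
inner product of [H(b)], the range of [A].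

The boundary function of [b] multiplies [H^2] into itself, so [S T = T S], and
removing the constant term of [h] before multiplying by [b] gives
[S^* T h = T S^* h + h(0) S^* b] ([commutator_rank1]).  Hence [S^* A^2 S] is
[A^2] minus the rank-one operator of [S^* b] ([defect_shift]).  Through the
lemma of Douglas ([range_douglas]) this inequality of quadratic forms puts
[S^* b] in [H(b)] and makes the restriction [X] of [S^*] a contraction of
[H(b)].  As [A^2] is the adjoint of the inclusion of [H(b)] in [H^2], the same
commutation relation gives [X^* h = S h - <h, S^* b>_b b]
([adjoint_restrE]), and therefore [X X^* h = h - <h, S^* b>_b S^* b].

Let [M] reduce [X].  By the last identity [<f, S^* b>_b S^* b] is in [M] for
every [f] in [M], so either [S^* b] lies in [M] or [M] is orthogonal to it.

Suppose first that [M] is orthogonal to [S^* b] and nonzero.  Then [X^*] is [S]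
on [M], and [M] contains [h - S S^* h = h(0)] for each of its elements [h];
moving a nonzero Taylor coefficient to the constant term by [S^*], we see that
[M] contains the constants, and then all monomials.  The same relation, used
under the inner product of [H(b)], shows [<f, z^n>_b = k <f, z^n>] for [f] in
[M], where [k] is the square of the norm of [1] in [H(b)].  For an arbitrary
[f] in [H(b)], let [g] be the projection on [M] of [A^2 f].  Then
[<f, z^n> = <A^2 f, z^n>_b = <g, z^n>_b = k <g, z^n>] for all [n], so
[f = k g] lies in [M]: hence [M] is everything ([reducing_orth_full]).

If instead [S^* b] lies in [M], the same argument applies to the orthogonal
complement of [M], which also reduces [X]; it is therefore zero or everything,
and [M] is everything or zero ([restr_not_reducible]).

All this takes place in abstract Hilbert spaces.  Three facts of analysis
connect it with the circle.  The space [L^2] is complete ([L2C_hilbert], by the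
Riesz-Fischer argument), which yields projections, adjoints and the lemma of
Douglas.  A bounded measurable function which is almost everywhere the radial
limit of a bounded analytic function multiplies [H^2] into itself
([radial_symbol], by dominated convergence, first for the Taylor polynomials on
a circle of radius [r] and then for [r] tending to 1).  Finally, a
square-integrable function whose Fourier coefficients all vanish is zero
([fourier_unique]): it is annihilated by the trigonometric polynomials
[(1 - v^n)^(2^n)], which converge boundedly to the indicator of an arc, so its
integral over every short arc vanishes, and Lebesgue differentiation concludes.

Square roots and boundary functions are introduced by a choice operator.  Its
default values are covered too: the range space of the zero operator is the
zero space, which has no nontrivial subspace ([range_zero_not_reducible]), and
the zero function also multiplies [H^2] into itself ([analytic0]). *)

Set Implicit Arguments.
Unset Strict Implicit.
Unset Printing Implicit Defensive.

Import Order.TTheory GRing.Theory Num.Theory.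
Import numFieldNormedType.Exports.

Local Open Scope classical_set_scope.
Local Open Scope complex_scope.
Local Open Scope ring_scope.

(** * Hilbert spaces inside a vector space, Riesz representation *)

(** The axioms are relative to the carrier.  Completeness is spelled out with
    [e] and [N] because a subset of a vector space with its own inner product
    carries no uniform structure. *)
Record hilbert (R : realType) (V : lmodType R[i]) (E : ipspace V) : Prop := Hilbert {
  hilbert0 : carrier E 0;
  hilbertP : forall (a : R[i]) x y, carrier E x -> carrier E y -> carrier E (a *: x + y);
  hilbert_lin : forall (a : R[i]) x y z, carrier E x -> carrier E y -> carrier E z ->
    ip E (a *: x + y) z = a * ip E x z + ip E y z;
  hilbert_conj : forall x y, carrier E x -> carrier E y -> ip E y x = (ip E x y)^*%C;
  hilbert_ge0 : forall x, carrier E x -> 0 <= ip E x x;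
  hilbert_def : forall x, carrier E x -> ip E x x = 0 -> x = 0;
  hilbert_complete : forall u : nat -> V, (forall n, carrier E (u n)) ->
    (forall e : R, 0 < e -> exists N, forall m n, (N <= m)%N -> (N <= n)%N ->
      ipnorm E (u m - u n) <= e) ->
    exists2 x, carrier E x & ipnorm E (u n - x) @[n --> \oo] --> (0 : R)
}.

Section HilbertTheory.
Context (R : realType) (V : lmodType R[i]) (E : ipspace V).
Hypothesis hE : hilbert E.
Local Notation car := (carrier E).
Local Notation rip x y := (complex.Re (ip E x y)).
Local Notation nsq x := (complex.Re (ip E x x)).

Lemma car0 : car 0. Proof. exact: (hilbert0 hE). Qed.
Lemma carZ (a : R[i]) x : car x -> car (a *: x).
Proof. by move=> cx; rewrite -[_ *: _]addr0; apply: (hilbertP hE) => //; exact: car0. Qed.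
Lemma carD x y : car x -> car y -> car (x + y).
Proof. by move=> cx cy; rewrite -[x]scale1r; exact: (hilbertP hE). Qed.
Lemma carN x : car x -> car (- x).
Proof. by move=> cx; rewrite -scaleN1r; exact: carZ. Qed.
Lemma carB x y : car x -> car y -> car (x - y).
Proof. by move=> cx cy; apply: carD => //; exact: carN. Qed.
Hint Resolve car0 carZ carD carN carB : core.

Lemma ipZDl (a : R[i]) x y z : car x -> car y -> car z ->
  ip E (a *: x + y) z = a * ip E x z + ip E y z.
Proof. exact: (hilbert_lin hE). Qed.
Lemma ip0l z : car z -> ip E 0 z = 0.
Proof.
move=> cz; have := ipZDl 1 car0 car0 cz; rewrite scale1r addr0 mul1r.
by move/(congr1 (fun t => t - ip E 0 z)); rewrite subrr addrK.
Qed.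
Lemma ipDl x y z : car x -> car y -> car z -> ip E (x + y) z = ip E x z + ip E y z.
Proof. by move=> cx cy cz; rewrite -{1}[x]scale1r ipZDl// mul1r. Qed.
Lemma ipZl (a : R[i]) x z : car x -> car z -> ip E (a *: x) z = a * ip E x z.
Proof. by move=> cx cz; rewrite -[a *: x]addr0 ipZDl// ip0l// addr0. Qed.
Lemma ipNl x z : car x -> car z -> ip E (- x) z = - ip E x z.
Proof. by move=> cx cz; rewrite -scaleN1r ipZl// mulN1r. Qed.
Lemma ipBl x y z : car x -> car y -> car z -> ip E (x - y) z = ip E x z - ip E y z.
Proof. by move=> cx cy cz; rewrite ipDl ?ipNl//; auto. Qed.
Lemma ipC x y : car x -> car y -> ip E y x = (ip E x y)^*%C.
Proof. exact: (hilbert_conj hE). Qed.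
Lemma ip0r z : car z -> ip E z 0 = 0.
Proof. by move=> cz; rewrite (ipC car0 cz) ip0l// rmorph0. Qed.
Lemma ipDr x y z : car x -> car y -> car z -> ip E z (x + y) = ip E z x + ip E z y.
Proof.
by move=> cx cy cz; rewrite (ipC _ cz) ?ipDl ?rmorphD/= -?ipC//; auto.
Qed.
Lemma ipZr (a : R[i]) x z : car x -> car z -> ip E z (a *: x) = a^*%C * ip E z x.
Proof.
by move=> cx cz; rewrite (ipC _ cz) ?ipZl ?rmorphM/= -?ipC//; auto.
Qed.
Lemma ipNr x z : car x -> car z -> ip E z (- x) = - ip E z x.
Proof.
by move=> cx cz; rewrite (ipC _ cz) ?ipNl ?rmorphN/= -?ipC//; auto.
Qed.
Lemma ipBr x y z : car x -> car y -> car z -> ip E z (x - y) = ip E z x - ip E z y.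
Proof. by move=> cx cy cz; rewrite ipDr ?ipNr//; auto. Qed.

Lemma ripC x y : car x -> car y -> rip x y = rip y x.
Proof. by move=> cx cy; rewrite (ipC cy cx); case: (ip E y x). Qed.
Lemma ip_nsq x : car x -> ip E x x = (nsq x)%:C.
Proof.
by move=> cx; have /ger0_Im := hilbert_ge0 hE cx; case: (ip E x x) => a b /= ->.
Qed.
Lemma nsq_ge0 x : car x -> 0 <= nsq x.
Proof. by move=> cx; have := hilbert_ge0 hE cx; rewrite (ip_nsq cx) lecR. Qed.
Lemma nsq_eq0 x : car x -> nsq x = 0 -> x = 0.
Proof. by move=> cx x0; apply: (hilbert_def hE) => //; rewrite ip_nsq// x0. Qed.
Lemma ip_eq0 x : car x -> (forall z, car z -> ip E x z = 0) -> x = 0.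
Proof. by move=> cx h; apply: (hilbert_def hE) => //; exact: h. Qed.
Lemma ip_inj x y : car x -> car y -> (forall z, car z -> ip E x z = ip E y z) -> x = y.
Proof.
move=> cx cy h; apply/eqP; rewrite -subr_eq0; apply/eqP/ip_eq0; auto.
by move=> z cz; rewrite ipBl// h// subrr.
Qed.
Lemma ip_injr x y : car x -> car y -> (forall z, car z -> ip E z x = ip E z y) -> x = y.
Proof.
by move=> cx cy h; apply: ip_inj => // z cz; rewrite (ipC cz cx) (ipC cz cy) h.
Qed.

Lemma ipnorm_ge0 x : 0 <= ipnorm E x. Proof. exact: sqrtr_ge0. Qed.
Lemma ipnorm_sqr x : car x -> ipnorm E x ^+ 2 = nsq x.
Proof. by move=> cx; rewrite sqr_sqrtr// nsq_ge0. Qed.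
Lemma ipnorm_eq0 x : car x -> ipnorm E x = 0 -> x = 0.
Proof. by move=> cx x0; apply: nsq_eq0; rewrite -?ipnorm_sqr// x0 expr0n. Qed.
Lemma ripBl x y z : car x -> car y -> car z -> rip (x - y) z = rip x z - rip y z.
Proof. by move=> cx cy cz; rewrite ipBl// raddfB. Qed.
Lemma nsqZD (t : R) x y : car x -> car y ->
  nsq (x + t%:C *: y) = nsq x + t * (rip x y *+ 2) + t ^+ 2 * nsq y.
Proof.
move=> cx cy; rewrite ipDl ?ipDr ?ipZl ?ipZr; auto.
rewrite (ipC cx cy); case: (ip E x x) (ip E y y) (ip E x y) => [a a'] [b b'] [c c'] /=.
by rewrite mulr2n; ring.
Qed.
Lemma nsqD x y : car x -> car y -> nsq (x + y) = nsq x + rip x y *+ 2 + nsq y.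
Proof.
by move=> cx cy; have := nsqZD 1 cx cy; rewrite scale1r expr1n !mul1r.
Qed.
Lemma ipnormB x y : car x -> car y -> ipnorm E (x - y) = ipnorm E (y - x).
Proof. by move=> cx cy; rewrite /ipnorm -opprB ipNl ?ipNr ?opprK; auto. Qed.

(** Cauchy-Schwarz, from the value of [|x + t y|^2] at its minimum.  Bounding the
    real part is enough below: [x] may be replaced by ['i x] in linear statements. *)
Lemma rip_le x y : car x -> car y -> rip x y <= ipnorm E x * ipnorm E y.
Proof.
move=> cx cy; have [y0|y_neq0] := eqVneq (nsq y) 0.
  by rewrite (nsq_eq0 cy y0) ip0r// mulr_ge0 ?ipnorm_ge0.
have y_gt0 : 0 < nsq y by rewrite lt_neqAle eq_sym y_neq0 nsq_ge0.
have h := nsq_ge0 (carD cx (carZ ((- (rip x y / nsq y))%:C) cy)).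
rewrite nsqZD// in h.
have {h} : rip x y ^+ 2 <= nsq x * nsq y.
  rewrite -subr_ge0 -(pmulr_lge0 _ (_ : 0 < (nsq y)^-1)) ?invr_gt0//.
  suff -> : (nsq x * nsq y - rip x y ^+ 2) / nsq y =
    nsq x + - (rip x y / nsq y) * (rip x y *+ 2) + (- (rip x y / nsq y)) ^+ 2 * nsq y by exact: h.
  by rewrite mulr2n; field.
rewrite -!ipnorm_sqr// -exprMn => h.
have [r0|r0] := lerP 0 (rip x y); last by rewrite (le_trans (ltW r0))// mulr_ge0 ?ipnorm_ge0.
by rewrite -(@ler_pXn2r _ 2)// nnegrE mulr_ge0 ?ipnorm_ge0.
Qed.

Lemma ler_ipnormD x y : car x -> car y -> ipnorm E (x + y) <= ipnorm E x + ipnorm E y.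
Proof.
move=> cx cy; rewrite -(@ler_pXn2r _ 2)// ?nnegrE ?addr_ge0 ?ipnorm_ge0//.
rewrite ipnorm_sqr; auto; rewrite nsqD// -!ipnorm_sqr//.
have := rip_le cx cy; nra.
Qed.

Lemma rip_cvg (u : nat -> V) x z : (forall n, car (u n)) -> car x -> car z ->
  ipnorm E (u n - x) @[n --> \oo] --> (0 : R) -> rip (u n) z @[n --> \oo] --> rip x z.
Proof.
move=> cu cx cz ux; apply/cvgrPdist_le => e e0.
have : ipnorm E (u n - x) * ipnorm E z @[n --> \oo] --> 0 * ipnorm E z.
  by apply: cvgM => //; exact: cvg_cst.
rewrite mul0r => /cvgrPdist_le/(_ _ e0).
apply: filterS => n; rewrite sub0r normrN ger0_norm ?mulr_ge0 ?ipnorm_ge0// => h.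
apply: le_trans h; rewrite ler_norml; apply/andP; split.
  by rewrite lerNl opprB -ripBl//; apply: rip_le; auto.
by rewrite -ripBl// ipnormB//; apply: rip_le; auto.
Qed.

Lemma ip_lim0 (u : nat -> V) x z : (forall n, car (u n)) -> car x -> car z ->
  ipnorm E (u n - x) @[n --> \oo] --> (0 : R) -> (forall n, ip E (u n) z = 0) -> ip E x z = 0.
Proof.
move=> cu cx cz ux u0.
have h z' : car z' -> (forall n, rip (u n) z' = 0) -> rip x z' = 0.
  move=> cz' h; have c := rip_cvg cu cx cz' ux.
  have e : (fun n => rip (u n) z') = cst 0 by apply/funext => n; rewrite h.
  by rewrite e in c; rewrite -(cvg_lim _ c)// lim_cst.
have h1 : rip x z = 0 by apply: h => // n; rewrite u0.
have h2 : rip x ('i%C *: z) = 0 by apply: h; auto => n; rewrite ipZr// u0 mulr0.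
move: h1 h2; rewrite ipZr//; case: (ip E x z) => a b /= -> /=.
by rewrite mulr0 sub0r mulN1r opprK => ->.
Qed.

Definition linear_on (W V' : lmodType R[i]) (G : set W) (A : W -> V') :=
  forall (a : R[i]) x y, G x -> G y -> A (a *: x + y) = a *: A x + A y.

Lemma quadratic_ge0_lin0 (a c : R) : (forall t : R, 0 <= t ^+ 2 * a + t * c) -> c = 0.
Proof.
move=> h; have a0 : 0 <= a.
  by have := addr_ge0 (h 1) (h (-1)); rewrite sqrrN expr1n !mul1r mulN1r; lra.
(* This [t] makes the value a negative multiple of [c ^+ 2]. *)
have := h (- (c / (a + 1) / 2)).
have -> : (- (c / (a + 1) / 2)) ^+ 2 * a + - (c / (a + 1) / 2) * c =
    - ((c / (a + 1)) ^+ 2 * ((a + 2) / 4)).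
  by field; lra.
rewrite oppr_ge0 pmulr_lle0; last by rewrite divr_gt0//; lra.
by rewrite le_eqVlt ltNge sqr_ge0 orbF sqrf_eq0 mulf_eq0 invr_eq0 => /orP[/eqP//|/eqP]; lra.
Qed.

(** The Riesz representation theorem in a form that contains Douglas' range
    lemma: a linear functional dominated by [|A g|] is represented against
    [A g].  The representing vector is the limit of [A g_n] along a minimizing
    sequence of [|A g|^2 - 2 Re (phi g)], which the parallelogram identity makes
    a Cauchy sequence; so the vector lies in the closure of the range of [A]. *)
Lemma riesz_douglas (W : lmodType R[i]) (G : set W) (A : W -> V) (phi : W -> R[i]) (C : R) :
  G 0 -> (forall (a : R[i]) x y, G x -> G y -> G (a *: x + y)) ->
  (forall g, G g -> car (A g)) -> linear_on G A ->
  linear_on G (phi : W -> R[i]^o) ->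
  0 <= C -> (forall g, G g -> complex.Re (phi g) <= C * ipnorm E (A g)) ->
  exists y, [/\ car y, forall g, G g -> phi g = ip E (A g) y, ipnorm E y <= C &
    exists2 u : nat -> W, forall n, G (u n) & ipnorm E (A (u n) - y) @[n --> \oo] --> (0 : R)].
Proof.
move=> G0 GP cA Alin philin C0 bnd.
pose Q g := nsq (A g) - complex.Re (phi g) *+ 2.
have QZD (t : R) g h : G g -> G h -> Q (t%:C *: h + g) =
    Q g + t * ((rip (A g) (A h) - complex.Re (phi h)) *+ 2) + t ^+ 2 * nsq (A h).
  move=> Gg Gh; rewrite /Q Alin// [X in nsq X]addrC nsqZD; auto.
  rewrite (philin t%:C h g Gh Gg).
  have -> : complex.Re (t%:C *: (phi h : R[i]^o) + phi g) =
      t * complex.Re (phi h) + complex.Re (phi g).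
    by case: (phi h) (phi g) => [p q] [p' q'] /=; rewrite mul0r subr0.
  by rewrite !mulr2n; ring.
have Qlb g : G g -> - C ^+ 2 <= Q g.
  move=> Gg; have := bnd _ Gg; rewrite /Q -ipnorm_sqr; last exact: cA.
  have := sqr_ge0 (ipnorm E (A g) - C); rewrite mulr2n; nra.
pose D := [set Q g | g in G].
have hD : has_inf D.
  by split; [exists (Q 0), 0|exists (- C ^+ 2) => _ [g Gg <-]; exact: Qlb].
have Qm g : G g -> inf D <= Q g by move=> Gg; apply: ge_inf; [case: hD|exists g].
have /choice[u hu] : forall n : nat, exists g, G g /\ Q g <= inf D + n.+1%:R^-1.
  move=> n; have n0 : 0 < n.+1%:R^-1 :> R by rewrite invr_gt0.
  have [_ [g Gg <-] /ltW h] := @inf_adherent _ D n.+1%:R^-1 n0 hD.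
  by exists g.
have Gu n : G (u n) by case: (hu n).
have cAu n : car (A (u n)) by exact: cA.
have Qu n : Q (u n) <= inf D + n.+1%:R^-1 by case: (hu n).
(* The parallelogram identity, in the form of [QZD] at the midpoint. *)
have close m n : nsq (A (u m) - A (u n)) <= 2 * (m.+1%:R^-1 + n.+1%:R^-1).
  pose k := (-1) *: u n + u m.
  have Gk : G k by exact: GP.
  have Ak : A k = A (u m) - A (u n) by rewrite Alin// scaleN1r addrC.
  have ek : 1%:C *: k + u n = u m.
    by rewrite rmorph1 scale1r /k scaleN1r addrAC addNr add0r.
  rewrite -Ak; have := Qm _ (GP (2^-1)%:C _ _ Gk (Gu n)); rewrite QZD//.
  have := QZD 1 _ _ (Gu n) Gk; rewrite ek expr1n !mul1r.
  have := Qu n; have := Qu m; move: (rip _ _ - _) => r.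
  set a := (m.+1%:R)^-1; set b := (n.+1%:R)^-1.
  have -> : (2^-1 : R) ^+ 2 = 1 / 4 by field.
  lra.
have [y cy uy] : exists2 y, car y & ipnorm E (A (u n) - y) @[n --> \oo] --> (0 : R).
  apply: (hilbert_complete hE) => // e e0.
  have /cvgrPdist_le/(_ (e ^+ 2 / 4)) := @cvg_harmonic R.
  case; first by rewrite divr_gt0// exprn_gt0.
  move=> N _ hN; exists N => m n Nm Nn.
  rewrite -(@ler_pXn2r _ 2)// ?nnegrE ?ipnorm_ge0 ?(ltW e0)// ipnorm_sqr; auto.
  apply: (le_trans (close m n)).
  have := hN _ Nm; have := hN _ Nn; rewrite /= !sub0r !normrN !ger0_norm ?invr_ge0//.
  by move: (m.+1%:R^-1) (n.+1%:R^-1) => a b; lra.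
(* The first variation of [Q] vanishes at the limit. *)
have repr h : G h -> complex.Re (phi h) = rip y (A h).
  move=> Gh; have cAh : car (A h) by exact: cA.
  suff /eqP : (rip y (A h) - complex.Re (phi h)) *+ 2 = 0.
    by rewrite mulrn_eq0/= subr_eq0 => /eqP.
  apply: (@quadratic_ge0_lin0 (nsq (A h))) => t.
  have c1 := rip_cvg cAu cy cAh uy.
  have c2 : t ^+ 2 * nsq (A h) + t * ((rip (A (u n)) (A h) - complex.Re (phi h)) *+ 2) + n.+1%:R^-1
     @[n --> \oo] --> t ^+ 2 * nsq (A h) + t * ((rip y (A h) - complex.Re (phi h)) *+ 2) + 0.
    apply: cvgD; last exact: cvg_harmonic.
    apply: cvgD; first exact: cvg_cst.
    apply: cvgM; first exact: cvg_cst.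
    rewrite mulr2n; under eq_fun do rewrite mulr2n.
    by apply: cvgD; (apply: cvgB; [exact: c1|exact: cvg_cst]).
  rewrite addr0 in c2; apply: (cvgr_to_ge c2); apply: nearW => n.
  have := Qm _ (GP t%:C _ _ Gh (Gu n)); rewrite QZD//.
  have := Qu n; set a := (n.+1%:R)^-1; lra.
(* Replacing [h] by ['i h] recovers the imaginary part. *)
have repr' h : G h -> phi h = ip E (A h) y.
  move=> Gh; have cAh : car (A h) by exact: cA.
  have h1 := repr _ Gh.
  have Gih : G ('i%C *: h) by rewrite -[_ *: _]addr0; exact: GP.
  have A0 : A 0 = 0.
    have := Alin 1 _ _ G0 G0; rewrite scale1r addr0 scale1r => /(congr1 (fun t => t - A 0)).
    by rewrite subrr addrK.
  have phi0 : phi 0 = 0.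
    have := philin 1 _ _ G0 G0; rewrite scale1r addr0 scale1r => /(congr1 (fun t => t - phi 0)).
    by rewrite subrr addrK.
  have h2 := repr _ Gih; have e1 := Alin 'i%C _ _ Gh G0; have e2 := philin 'i%C _ _ Gh G0.
  rewrite addr0 A0 addr0 in e1; rewrite addr0 phi0 addr0 in e2.
  move: h2; rewrite e1 e2 ripC// ?ipZl//; auto.
  rewrite ripC// in h1; move: h1; case: (phi h) (ip E (A h) y) => [a b] [c d] /= ->.
  by rewrite !mul0r !sub0r !mul1r => /oppr_inj ->.
exists y; split => //; last by exists u.
have c1 := rip_cvg cAu cy cy uy.
have c2 : C * (ipnorm E y + ipnorm E (A (u n) - y)) @[n --> \oo] --> C * (ipnorm E y + 0).
  by apply: cvgM; [exact: cvg_cst|apply: cvgD => //; exact: cvg_cst].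
have : nsq y <= C * ipnorm E y.
  rewrite -[X in C * X]addr0 -(cvg_lim _ c1)// -(cvg_lim _ c2)//.
  apply: ler_lim; [by apply/cvg_ex; eexists; exact: c1|by apply/cvg_ex; eexists; exact: c2|].
  apply: nearW => n; rewrite -repr'//; apply: (le_trans (bnd _ (Gu n))); apply: ler_wpM2l => //.
  by rewrite -{1}[A (u n)](addrNK y) addrC; apply: ler_ipnormD; auto.
rewrite -ipnorm_sqr// expr2; have [->|n0] := eqVneq (ipnorm E y) 0; first by rewrite !mulr0.
by rewrite ler_pM2r// lt_neqAle eq_sym n0 ipnorm_ge0.
Qed.

End HilbertTheory.

(** * Projections, adjoints and range spaces *)

Section Consequences.
Context (R : realType) (V : lmodType R[i]) (E : ipspace V).
Hypothesis hE : hilbert E.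
Local Notation car := (carrier E).
Hint Resolve car0 carZ carD carN carB : core.

(** The projection of [x] represents the functional [<., x>] on [M]. *)
Lemma orth_proj_spec M x : closed_subspace E M -> car x ->
  M (orth_proj E M x) /\ forall z, M z -> ip E (x - orth_proj E M x) z = 0.
Proof.
move=> [ME M0 ML Mcl] cx; rewrite /orth_proj.
apply: (@xgetPex _ 0 [set y | M y /\ forall z, M z -> ip E (x - y) z = 0]).
have [|z Mz|a u v Mu Mv|a u v Mu Mv|||y [cy phiy _ [u Mu uy]]] :=
    @riesz_douglas _ _ _ hE V M id (fun z => ip E z x) (ipnorm E x) M0.
- by move=> a u v; exact: ML.
- exact: ME.
- by [].
- by rewrite (ipZDl hE) ?scalerE//; exact: ME.
- exact: ipnorm_ge0.
- by move=> g Mg; rewrite mulrC; apply: (rip_le hE) => //; exact: ME.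
- exists y; split; first exact: (Mcl u).
  move=> z Mz; have cz := ME _ Mz.
  by rewrite (ipBl hE)// (ipC hE cz)// (ipC hE cz cy) phiy// subrr.
Qed.

(** The adjoint at [x] represents the functional [<T ., x>]. *)
Lemma adjoint_spec (T : V -> V) (c : R) x : (forall x, car x -> car (T x)) ->
  linear_on car T -> 0 <= c -> (forall x, car x -> ipnorm E (T x) <= c * ipnorm E x) ->
  car x -> car (adjoint E T x) /\ forall z, car z -> ip E (T z) x = ip E z (adjoint E T x).
Proof.
move=> cT Tlin c0 bT cx.
apply: (@xgetPex _ 0 [set y | car y /\ forall z, car z -> ip E (T z) x = ip E z y]).
have [|||a u v cu cv||g cg|y [cy phiy _ _]] :=
    @riesz_douglas _ _ _ hE V car id (fun z => ip E (T z) x) (c * ipnorm E x) (car0 hE).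
- exact: hilbertP.
- by [].
- by [].
- by rewrite Tlin// (ipZDl hE) ?scalerE//; exact: cT.
- by rewrite mulr_ge0// ipnorm_ge0.
- apply: le_trans (rip_le hE (cT _ cg) cx) _.
  by rewrite mulrAC; apply: ler_wpM2r; [exact: ipnorm_ge0|exact: bT].
- by exists y.
Qed.

(** This covers both orthogonal complements and [H^2], which is the orthogonal of
    the monomials of negative degree. *)
Lemma orth_closed N : N `<=` car ->
  closed_subspace E [set x | car x /\ forall z, N z -> ip E x z = 0].
Proof.
move=> NE; split.
- by move=> x [].
- by split=> [|z Nz]; [exact: car0|rewrite (ip0l hE)//; exact: NE].
- move=> a x y [cx hx] [cy hy]; split; first exact: hilbertP.
  by move=> z Nz; rewrite (ipZDl hE) ?hx ?hy ?mulr0 ?addr0//; exact: NE.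
- move=> u x hu cx ux; split=> // z Nz.
  by apply: (ip_lim0 hE _ cx (NE _ Nz) ux) => n; case: (hu n) => // _; exact.
Qed.

(** Linearity of [T] is inherited from that of the inner product, because vectors
    are determined by their inner products. *)
Lemma adjoint_pair_linear (T Ts : V -> V) : (forall x, car x -> car (T x)) ->
  (forall x, car x -> car (Ts x)) ->
  (forall x y, car x -> car y -> ip E (T x) y = ip E x (Ts y)) -> linear_on car T.
Proof.
move=> cT cTs adj a x y cx cy; apply: (ip_inj hE).
- by apply: cT; exact: hilbertP.
- by apply: (hilbertP hE); exact: cT.
- move=> z cz; have [cTx cTy cTz] := And3 (cT _ cx) (cT _ cy) (cTs _ cz).
  have cxy := hilbertP hE a cx cy.
  by rewrite adj// !(ipZDl hE)// !adj.
Qed.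

Lemma linear_on0 (T : V -> V) : linear_on car T -> T 0 = 0.
Proof.
move=> Tl; have := Tl 1 _ _ (car0 hE) (car0 hE).
by rewrite scale1r addr0 scale1r => /(congr1 (fun t => t - T 0)); rewrite subrr addrK.
Qed.

Lemma linear_onB (T : V -> V) x y : linear_on car T -> car x -> car y -> T (x - y) = T x - T y.
Proof.
by move=> Tl cx cy; have := Tl (-1) _ _ cy cx; rewrite !scaleN1r addrC => ->; rewrite addrC.
Qed.

Lemma linear_onZ (T : V -> V) a x : linear_on car T -> car x -> T (a *: x) = a *: T x.
Proof.
by move=> Tl cx; have := Tl a _ _ cx (car0 hE); rewrite (linear_on0 Tl) !addr0.
Qed.

Section RangeSpace.
Variable A : V -> V.
Hypothesis bA : bounded_op E A.

Let cA x : car x -> car (A x). Proof. by case: bA => h _ _; exact: h. Qed.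
Let linA : linear_on car A. Proof. by case: bA. Qed.
Local Notation Ar := (range_space E A).
Local Notation lift := (coimage_lift E A).

Lemma op_ker_closed : closed_subspace E (op_ker E A).
Proof.
have A0 := linear_on0 linA; split.
- by move=> x [].
- by split=> //; exact: car0.
- move=> a x y [cx hx] [cy hy]; split; first exact: hilbertP.
  by rewrite linA// hx hy scaler0 addr0.
- move=> u x hu cx ux; split=> //.
  have cu n : car (u n) by case: (hu n).
  case: bA => _ _ [c hc]; apply: (ipnorm_eq0 hE); first exact: cA.
  apply/eqP; rewrite eq_le ipnorm_ge0 andbT.
  have h : c * ipnorm E (u n - x) @[n --> \oo] --> c * 0.
    by apply: cvgM => //; exact: cvg_cst.
  rewrite mulr0 in h; apply: (cvgr_to_ge h); apply: nearW => n.
  have Aun : A (u n) = 0 by case: (hu n).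
  have := hc _ (carB hE (cu n) cx).
  rewrite (linear_onB linA (cu n) cx) Aun sub0r.
  rewrite {1}/ipnorm (ipNl hE) ?(ipNr hE) ?opprK//; by [exact: cA|exact: carN|auto].
Qed.

Lemma coimage_closed : closed_subspace E (coimage E A).
Proof. by apply: orth_closed => x []. Qed.

Lemma coimageE f : coimage E A f -> car f. Proof. by case. Qed.

Lemma coimage_lift_spec x : carrier Ar x -> coimage E A (lift x) /\ A (lift x) = x.
Proof.
move=> [g cg <-]; apply: (@xgetPex _ 0 [set f | coimage E A f /\ A f = A g]).
have [[cp kp] orthp] := orth_proj_spec op_ker_closed cg.
exists (g - orth_proj E (op_ker E A) g); split; first by split=> //; exact: carB.
by rewrite linear_onB// kp subr0.
Qed.

Lemma coimage_inj f g : coimage E A f -> coimage E A g -> A f = A g -> f = g.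
Proof.
move=> [cf hf] [cg hg] e; apply/eqP; rewrite -subr_eq0; apply/eqP.
have cfg := carB hE cf cg.
have k : op_ker E A (f - g) by split=> //; rewrite linear_onB// e subrr.
by apply: (hilbert_def hE) => //; rewrite {1}(ipBl hE)// hf// hg// subrr.
Qed.

Lemma coimage_liftK f : coimage E A f -> lift (A f) = f.
Proof.
move=> hf; have [|h1 h2] := @coimage_lift_spec (A f); first by exists f => //; exact: coimageE.
exact: coimage_inj.
Qed.

Lemma coimage_liftZD (a : R[i]) x y : carrier Ar x -> carrier Ar y ->
  lift (a *: x + y) = a *: lift x + lift y.
Proof.
move=> /coimage_lift_spec[h1 h2] /coimage_lift_spec[h3 h4].
have [_ _ ML _] := coimage_closed.
by rewrite -{1}h2 -{1}h4 -linA ?coimage_liftK//; [exact: ML|exact: coimageE|exact: coimageE].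
Qed.

Lemma range_sub : carrier Ar `<=` car.
Proof. by move=> x [g cg <-]; exact: cA. Qed.

Lemma lift_car x : carrier Ar x -> car (lift x).
Proof. by move=> /coimage_lift_spec[/coimageE]. Qed.

Lemma rangeZD (a : R[i]) x y : carrier Ar x -> carrier Ar y -> carrier Ar (a *: x + y).
Proof.
move=> [g cg <-] [h ch <-]; exists (a *: g + h); first exact: hilbertP.
exact: linA.
Qed.

(** By construction [A] is an isometry from its coimage, a closed subspace, onto
    the range space. *)
Lemma hilbert_range : hilbert Ar.
Proof.
have cL := lift_car; split.
- by exists 0; [exact: car0|exact: linear_on0].
- exact: rangeZD.
- move=> a x y z cx cy cz /=; rewrite coimage_liftZD// (ipZDl hE)//; exact: cL.
- by move=> x y cx cy /=; apply: (ipC hE); exact: cL.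
- by move=> x cx; apply: (hilbert_ge0 hE); exact: cL.
- move=> x cx /= h; have [_ <-] := coimage_lift_spec cx.
  by rewrite (hilbert_def hE _ h) ?linear_on0//; exact: cL.
- move=> u cu cauchy.
  have LB x y : carrier Ar x -> carrier Ar y -> lift (x - y) = lift x - lift y.
    move=> cx cy; have := coimage_liftZD (-1) cy cx.
    by rewrite !scaleN1r addrC => ->; rewrite addrC.
  have [|e e0|f cf uf] := hilbert_complete hE (u := fun n => lift (u n)).
  + by move=> n; exact: cL.
  + have [N hN] := cauchy e e0; exists N => m n Nm Nn; have := hN _ _ Nm Nn.
    by rewrite /ipnorm /= LB.
  have hf : coimage E A f.
    have [_ _ _ cl] := coimage_closed.
    by apply: (cl (fun n => lift (u n))) => // n; case: (coimage_lift_spec (cu n)).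
  exists (A f); first by exists f.
  have e n : ipnorm Ar (u n - A f) = ipnorm E (lift (u n) - f).
    by rewrite /ipnorm /= LB ?coimage_liftK//; exists f.
  by under eq_fun do rewrite e.
Qed.

Hypothesis selfA : forall x y, car x -> car y -> ip E (A x) y = ip E x (A y).

Lemma range_coimage x : car x -> coimage E A (A x).
Proof.
move=> cx; split; first exact: cA.
by move=> g [cg Ag]; rewrite selfA// Ag (ip0r hE).
Qed.

(** For self-adjoint [A] the vector [A g] is in the coimage, so it is the lift of
    [A (A g)]; hence [A^2] is the adjoint of the inclusion of the range space. *)
Lemma range_ip_sqr x g : carrier Ar x -> car g -> ip Ar x (A (A g)) = ip E x g.
Proof.
move=> cx cg; rewrite /= coimage_liftK; last exact: range_coimage.
by have [h1 h2] := coimage_lift_spec cx; rewrite -selfA ?h2//; exact: coimageE.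
Qed.

(** The representing vector [y] of [<., x>] against [A] satisfies [A y = x] since
    [A] is self-adjoint, and it is in the coimage since it is a limit of values
    of [A]; thus its norm is that of [x] in the range space. *)
Lemma range_douglas x (C : R) : car x -> 0 <= C ->
  (forall g, car g -> complex.Re (ip E g x) <= C * ipnorm E (A g)) ->
  carrier Ar x /\ ipnorm Ar x <= C.
Proof.
move=> cx C0 bnd.
have [|||a u v cu cv|||y [cy phiy yC [u cu uy]]] := @riesz_douglas _ _ _ hE V car A
    (fun z => ip E z x) C (car0 hE).
- exact: hilbertP.
- exact: cA.
- exact: linA.
- by rewrite (ipZDl hE).
- by [].
- by [].
- have e : x = A y.
    by apply: (ip_injr hE) => //; [exact: cA|move=> z cz; rewrite -selfA// phiy].
  have hy : coimage E A y.
    have [_ _ _ cl] := coimage_closed; apply: (cl (fun n => A (u n))) => // n.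
    exact: range_coimage.
  by split; [exists y|rewrite e /ipnorm/= coimage_liftK].
Qed.

End RangeSpace.

(** Polarization: [<A w, w>] is real for [w = x + y] and for [w = 'i x + y], which
    compares the imaginary and the real parts of [<A x, y>] and [<x, A y>]. *)
Lemma positive_selfadjoint (A : V -> V) : positive_op E A ->
  forall x y, car x -> car y -> ip E (A x) y = ip E x (A y).
Proof.
move=> [[cA linA _] pos].
have im x : car x -> complex.Im (ip E (A x) x) = 0 by move=> /pos/ger0_Im.
move=> x y cx cy; have cAx := cA _ cx; have cAy := cA _ cy.
have := im _ (hilbertP hE 1 cx cy); have := im _ (hilbertP hE 'i%C cx cy).
rewrite !linA// !(ipZDl hE, ipDr hE, ipZr hE)//; auto.
have := im _ cx; have := im _ cy; rewrite (ipC hE cAy cx).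
case: (ip E (A x) x) (ip E (A y) y) (ip E (A x) y) (ip E (A y) x) => [a b] [c d] [e f] [g h] /=.
by move=> -> -> h1 h2; congr (_ +i* _); lra.
Qed.

End Consequences.

Lemma hilbert_sub (R : realType) (V : lmodType R[i]) (E : ipspace V) (M : set V) :
  hilbert E -> closed_subspace E M -> hilbert {| carrier := M; ip := ip E |}.
Proof.
move=> hE [ME M0 ML Mcl]; split => //=.
- by move=> a x y z Mx My Mz; apply: (hilbert_lin hE); exact: ME.
- by move=> x y Mx My; apply: (hilbert_conj hE); exact: ME.
- by move=> x Mx; apply: (hilbert_ge0 hE); exact: ME.
- by move=> x Mx; apply: (hilbert_def hE); exact: ME.
- move=> u Mu cu; have [|//|x cx ux] := hilbert_complete hE (u := u); first by move=> n; exact: ME.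
  by exists x => //; exact: (Mcl u).
Qed.

Lemma orth_proj_id (R : realType) (V : lmodType R[i]) (E : ipspace V) (M : set V) x :
  hilbert E -> closed_subspace E M -> M x -> orth_proj E M x = x.
Proof.
move=> hE clM Mx; have [ME M0 ML Mcl] := clM.
have [Mp hp] := orth_proj_spec hE clM (ME _ Mx).
apply/esym/eqP; rewrite -subr_eq0; apply/eqP/(hilbert_def hE).
  by apply: (carB hE); exact: ME.
by apply: hp; rewrite addrC -scaleN1r; exact: ML.
Qed.

(** * Restrictions of the backward shift to a range space *)

(** The model for the hypotheses is [H^2] with the shift [S], the backward shift
    [Ss], multiplication [B] by [b] with its adjoint [Bs], and the constant
    function [one]; [A] is the square root of [I - B Bs].  In the comments [S^*]
    and [B^*] stand for [Ss] and [Bs]. *)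
Section Irreducible.
Context (R : realType) (V : lmodType R[i]) (E : ipspace V).
Local Notation car := (carrier E).
Variables (S Ss B Bs A : V -> V) (one : V).
Hypothesis hE : hilbert E.
Hypotheses (cS : forall x, car x -> car (S x)) (cSs : forall x, car x -> car (Ss x)).
Hypotheses (cB : forall x, car x -> car (B x)) (cBs : forall x, car x -> car (Bs x)).
Hypothesis adjS : forall x y, car x -> car y -> ip E (S x) y = ip E x (Ss y).
Hypothesis adjB : forall x y, car x -> car y -> ip E (B x) y = ip E x (Bs y).
Hypothesis SsK : forall x, car x -> Ss (S x) = x.
Hypothesis cone : car one.
Hypothesis one_norm : ip E one one = 1.
Hypothesis wold : forall x, car x -> x = S (Ss x) + ip E x one *: one.
Hypothesis BS : forall x, car x -> B (S x) = S (B x).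
Hypothesis total : forall x, car x -> (forall n, ip E x (iter n S one) = 0) -> x = 0.
Hypothesis posA : positive_op E A.
Hypothesis sqrA : forall x, car x -> A (A x) = x - B (Bs x).
Local Notation b := (B one).
Local Notation v := (Ss (B one)).
Local Notation Hb := (range_space E A).
Local Notation carb := (carrier (range_space E A)).

Hint Resolve car0 carZ carD carN carB cS cSs cB cBs cone : core.

Let bA : bounded_op E A. Proof. by case: posA. Qed.
Let cA x : car x -> car (A x). Proof. by case: bA => h _ _; exact: h. Qed.
Let selfA := positive_selfadjoint hE posA.
Let hHb : hilbert Hb := hilbert_range hE bA.
Let adjS' x y : car x -> car y -> ip E (Ss x) y = ip E x (S y).
Proof. by move=> cx cy; rewrite (ipC hE)// -?adjS -?(ipC hE); auto. Qed.
Let adjB' x y : car x -> car y -> ip E (Bs x) y = ip E x (B y).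
Proof. by move=> cx cy; rewrite (ipC hE)// -?adjB -?(ipC hE); auto. Qed.
Let linSs : linear_on car Ss := adjoint_pair_linear hE cSs cS adjS'.
Let linB : linear_on car B := adjoint_pair_linear hE cB cBs adjB.
Let cv : car v. Proof. by auto. Qed.

(** Only the constant term of [x], which [S^*] kills, prevents [S^*] and [B] from
    commuting on [x]. *)
Lemma commutator_rank1 x : car x -> Ss (B x) = B (Ss x) + ip E x one *: v.
Proof.
move=> cx; rewrite {1}(wold cx) addrC linB; auto.
by rewrite BS ?linSs ?SsK; auto; rewrite addrC.
Qed.

Let BsSs x : car x -> Bs (Ss x) = Ss (Bs x).
Proof.
move=> cx; apply: (ip_injr hE); auto => z cz.
by rewrite -adjB -?adjS -?adjS -?adjB ?BS; auto.
Qed.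

(** As [S] is isometric and [|A y|^2 = |y|^2 - |B^* y|^2], only [|B^* (S g)|^2] and
    [|B^* g|^2] have to be compared.  But [B^* g] is the backward shift of
    [B^* (S g)], whose constant term is [<g, S^* b>]. *)
Lemma defect_shift g : car g ->
  ip E (A (S g)) (A (S g)) + ip E g v * ip E v g = ip E (A g) (A g).
Proof.
have nA y : car y -> ip E (A y) (A y) = ip E y y - ip E (Bs y) (Bs y).
  by move=> cy; rewrite selfA ?sqrA ?(ipBr hE) -?adjB'; auto.
move=> cg; rewrite !nA ?adjS ?SsK; auto.
have cx : car (Bs (S g)) by auto.
have sx : Ss (Bs (S g)) = Bs g by rewrite -BsSs ?SsK; auto.
have x1 : ip E (Bs (S g)) one = ip E g v by rewrite adjB' ?adjS; auto.
rewrite {1}(wold cx) sx x1 (ipDl hE) ?(ipZl hE) ?adjS ?sx; auto.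
rewrite [ip E one _](ipC hE cx cone) x1 [ip E v g](ipC hE cg cv).
by rewrite opprD addrA addrNK.
Qed.

Lemma le_ipnorm x y : car x -> car y -> ip E x x <= ip E y y -> ipnorm E x <= ipnorm E y.
Proof. by move=> cx cy; rewrite (ip_nsq hE cx) (ip_nsq hE cy) lecR => h; exact: ler_wsqrtr. Qed.

Lemma defect_shift_le g : car g -> ipnorm E (A (S g)) <= ipnorm E (A g).
Proof.
move=> cg; apply: le_ipnorm; auto; rewrite -(defect_shift cg) lerDl.
by rewrite [ip E v g](ipC hE cg cv) mul_conjC_ge0.
Qed.

Lemma defect_shift_ge g : car g -> complex.Re (ip E g v) <= ipnorm E (A g).
Proof.
move=> cg; have := defect_shift cg; rewrite [ip E v g](ipC hE cg cv).
have [cAg cAS] : car (A g) /\ car (A (S g)) by auto.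
rewrite (ip_nsq hE cAg) (ip_nsq hE cAS) -(ipnorm_sqr hE cAg) -(ipnorm_sqr hE cAS).
have := ipnorm_ge0 E (A g); move: (ipnorm E (A g)) (ipnorm E (A (S g))) => p q p0.
case: (ip E g v) => c d /= [h _].
have [c0|c0] := lerP 0 c; last by rewrite (le_trans (ltW c0)).
rewrite -(@ler_pXn2r _ 2)// -h; nra.
Qed.

(** For [x = A u] one has [<g, S^* x> = <A (S g), u>], and [|A (S g)| <= |A g|]. *)
Lemma range_backward_shift x : carb x -> carb (Ss x) /\ ipnorm Hb (Ss x) <= ipnorm Hb x.
Proof.
move=> cx; have cx' := range_sub bA cx.
apply: (range_douglas hE bA selfA); auto; first exact: ipnorm_ge0.
move=> g cg; have [h1 h2] := coimage_lift_spec hE bA cx; have [cL _] := h1.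
rewrite -adjS// -{1}h2 -selfA; auto.
apply: le_trans (rip_le hE _ cL) _; auto; rewrite mulrC.
by apply: ler_wpM2l; [exact: ipnorm_ge0|exact: defect_shift_le].
Qed.

(** This is the lemma of Douglas for the rank-one part of [defect_shift]. *)
Lemma range_defect_vector : carb v.
Proof.
have [] // := @range_douglas _ _ _ hE _ bA selfA v 1 cv ler01.
by move=> g cg; rewrite mul1r; exact: defect_shift_ge.
Qed.

Variable X : V -> V.
Hypothesis X_E : forall x, carb x -> X x = Ss x.

Let cbX x : carb x -> carb (X x).
Proof. by move=> cx; rewrite X_E//; case: (range_backward_shift cx). Qed.

Lemma adjoint_restr_spec x : carb x ->
  carb (adjoint Hb X x) /\ forall z, carb z -> ip Hb (X z) x = ip Hb z (adjoint Hb X x).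
Proof.
move=> cx; apply: (@adjoint_spec _ _ _ hHb X 1 x) => //.
- move=> a y z cy cz; rewrite !X_E//; last exact: (rangeZD hE bA).
  by apply: linSs; exact: (range_sub bA).
- by move=> y cy; rewrite X_E// mul1r; case: (range_backward_shift cy).
Qed.

Let ipbC x y := @ipC _ _ _ hHb x y.

(** Both sides are tested against [g] in [E].  Since [A^2] is the adjoint of the
    inclusion, [<X^* h, g> = <h, S^* A^2 g>_b], and [commutator_rank1] moves
    [S^*] past [A^2]. *)
Lemma adjoint_restrE h : carb h -> adjoint Hb X h = S h - ip Hb h v *: b.
Proof.
move=> ch; have [cy hy] := adjoint_restr_spec ch.
have cyE := range_sub bA cy; have chE := range_sub bA ch.
have cvb := range_defect_vector.
apply: (ip_inj hE); auto => g cg.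
have cAA g' : car g' -> carb (A (A g')) by move=> cg'; exists (A g'); auto.
rewrite -(range_ip_sqr hE bA selfA cy cg) ipbC -?hy; auto.
rewrite -ipbC; auto.
have -> : X (A (A g)) = A (A (Ss g)) - ip E (Bs g) one *: v.
  rewrite X_E; auto; rewrite !sqrA; auto.
  rewrite (linear_onB linSs); auto; rewrite commutator_rank1; auto.
  by rewrite BsSs// opprD addrA.
have cvz a : carb (a *: v) by exact: (carZ hHb).
have cAg := cAA _ (cSs cg).
rewrite (ipBr hHb)//.
rewrite (range_ip_sqr hE bA selfA)// ?(ipZr hHb)//; auto.
rewrite (ipBl hE)// ?(ipZl hE)//; auto.
by rewrite adjS// adjB// -(ipC hE)//; auto; rewrite mulrC.
Qed.

Let cbB x y : carb x -> carb y -> carb (x - y). Proof. exact: (carB hHb). Qed.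
Let cbZ (a : R[i]) x : carb x -> carb (a *: x). Proof. exact: (carZ hHb). Qed.

Let Ss1 : Ss one = 0.
Proof.
have h := wold cone; rewrite one_norm scale1r in h.
have h0 : S (Ss one) = 0 by apply: (addIr one); rewrite -h add0r.
by rewrite -(SsK (cSs cone)) h0 (linear_on0 hE linSs).
Qed.

(** On [M] the adjoint of [X] is [S], so the projections [f - S S^* f] put the
    constants, and then every [S^n 1], into [M]; there the two inner products
    against [S^n 1] are proportional, which identifies the projection on [M] of
    [A^2 x] with a multiple of [x]. *)
Lemma reducing_orth_full M f : reducing_subspace Hb X M -> (forall x, M x -> ip Hb x v = 0) ->
  M f -> f <> 0 -> carb `<=` M.
Proof.
move=> [clM XM XsM] orthv Mf f0; have [ME M0 ML Mcl] := clM.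
have MZ (a : R[i]) x : M x -> M (a *: x) by move=> Mx; rewrite -[_ *: _]addr0; exact: ML.
have XsE x : M x -> adjoint Hb X x = S x.
  by move=> Mx; rewrite adjoint_restrE ?orthv ?scale0r ?subr0//; exact: ME.
have XE x : M x -> X x = Ss x by move=> Mx; rewrite X_E//; exact: ME.
have MS x : M x -> M (S x) by move=> Mx; rewrite -XsE//; apply: XsM; exists x.
have MSs x : M x -> M (Ss x) by move=> Mx; rewrite -XE//; apply: XM; exists x.
have MC x : M x -> car x by move=> Mx; apply: (range_sub bA); exact: ME.
have M1 : M one.
  have [n hn] : exists n, ip E f (iter n S one) <> 0.
    apply: contrapT => /forallNP h; apply: f0; apply: total; first exact: MC.
    by move=> n; apply: contrapT; exact: h.
  have Mn : M (iter n Ss f) by clear hn; elim: n => [//|n IH]; rewrite iterS; exact: MSs.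
  have {hn} hn : ip E (iter n Ss f) one <> 0.
    suff -> : ip E (iter n Ss f) one = ip E f (iter n S one) by [].
    elim: n f Mf {f0 hn Mn} => //= n IH f Mf.
    by rewrite -iterS iterSr IH ?adjS'//; [exact: MC|elim: (n) => //= m; auto|exact: MSs].
  have -> : one = (ip E (iter n Ss f) one)^-1 *: ((-1) *: S (Ss (iter n Ss f)) + iter n Ss f).
    rewrite {3}(wold (MC _ Mn)) scaleN1r addrA addNr add0r scalerA mulVf ?scale1r//.
    exact/eqP.
  by apply: MZ; apply: ML => //; apply: MS; exact: MSs.
have M1n n : M (iter n S one) by elim: n => //= n; exact: MS.
have k0 : ip Hb one one != 0.
  apply/eqP => h; have := one_norm.
  rewrite (hilbert_def hHb (ME _ M1) h) (ip0l hE); last exact: car0.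
  by move/eqP; rewrite eq_sym oner_eq0.
have ip1 x : M x -> ip Hb x one = ip Hb one one * ip E x one.
  move=> Mx; have MSx := MSs _ Mx; have MSSx := MS _ MSx.
  rewrite {1}(wold (MC _ Mx)) (ipDl hHb)//; [|exact: ME|exact/cbZ/ME|exact: ME].
  rewrite (ipZl hHb); [|exact: ME|exact: ME].
  have cb1 := ME _ M1.
  rewrite (ipbC cb1 (ME _ MSSx)) -(XsE _ MSx) -(adjoint_restr_spec (ME _ MSx)).2//.
  by rewrite (XE _ M1) Ss1 (ip0l hHb (ME _ MSx)) rmorph0 add0r mulrC.
have ipn n x : M x -> ip Hb x (iter n S one) = ip Hb one one * ip E x (iter n S one).
  elim: n x => [|n IH] x Mx; first exact: ip1.
  rewrite iterS.
  rewrite -(XsE _ (M1n n)) -(adjoint_restr_spec (ME _ (M1n n))).2; last exact: ME.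
  rewrite (XsE _ (M1n n)).
  by rewrite XE// IH ?adjS'//; [exact: MC|exact: MC|exact: MSs].
move=> x cx; have cxE := range_sub bA cx.
have cAAx : carb (A (A x)) by exists (A x); auto.
have [Mg hg] := orth_proj_spec hHb clM cAAx.
set g := orth_proj _ _ _ in Mg hg.
suff -> : x = ip Hb one one *: g by exact: MZ.
apply/eqP; rewrite -subr_eq0; apply/eqP; apply: total; first by apply: (carB hE); auto.
move=> n; have Mn := M1n n; have cMn := MC _ Mn.
rewrite (ipBl hE) ?(ipZl hE)//; auto.
have := hg _ Mn; rewrite (ipBl hHb)//; [|exact: ME|exact: ME].
rewrite (ipn n g Mg) (ipbC (ME _ Mn) cAAx) (range_ip_sqr hE bA selfA (ME _ Mn) cxE).
by rewrite -(ipC hE cMn cxE).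
Qed.

(** [X X^* f = f - <f, S^* b>_b S^* b], so [M] contains [S^* b] or is orthogonal to
    it.  In the first case the orthogonal complement of [M] is in the second. *)
Theorem restr_not_reducible : ~ reducible Hb X.
Proof.
move=> [M [redM Mn0 MnE]]; have [clM XM XsM] := redM; have [ME M0 ML Mcl] := clM.
have cvb := range_defect_vector.
have nz (N : set V) : N 0 -> N <> [set 0] -> exists2 f, N f & f <> 0.
  move=> N0 h; apply: contrapT => hn; apply: h; apply/seteqP; split => [x Nx|x ->//].
  by apply: contrapT => x0; apply: hn; exists x.
have [orthv|] := pselect (forall x, M x -> ip Hb x v = 0).
  have [f Mf f0] := nz _ M0 Mn0; apply: MnE; apply/seteqP; split=> //.
  exact: reducing_orth_full Mf f0.
move=> /existsNP[f /not_implyP[Mf fv]].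
have Mv : M v.
  have cf := ME _ Mf; have cfE := range_sub bA cf.
  have Ms : M (adjoint Hb X f) by apply: XsM; exists f.
  have MXs : M (X (adjoint Hb X f)) by apply: XM; exists (adjoint Hb X f).
  have e : X (adjoint Hb X f) = f - ip Hb f v *: v.
    rewrite (X_E (adjoint_restr_spec cf).1) adjoint_restrE//.
    by rewrite (linear_onB linSs) ?(linear_onZ hE _ linSs) ?SsK; auto.
  have -> : v = (ip Hb f v)^-1 *: ((-1) *: X (adjoint Hb X f) + f) + 0.
    rewrite e scaleN1r opprB addrNK scalerA mulVf ?scale1r ?addr0//; exact/eqP.
  by apply: (ML) => //; exact: ML.
pose N := [set x | carb x /\ forall z, M z -> ip Hb x z = 0].
have clN : closed_subspace Hb N by exact: orth_closed.
have [NE N0 NL _] := clN.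
have redN : reducing_subspace Hb X N.
  split=> // _ [x [cx hx] <-]; split.
  - exact: cbX.
  - move=> z Mz; rewrite (adjoint_restr_spec (ME _ Mz)).2//; apply: hx.
    by apply: XsM; exists z.
  - exact: (adjoint_restr_spec cx).1.
  - move=> z Mz; have cz := ME _ Mz; rewrite ipbC//; last exact: (adjoint_restr_spec cx).1.
    rewrite -(adjoint_restr_spec cx).2// -ipbC//; last exact: cbX.
    by apply: hx; apply: XM; exists z.
have [NN0|/(nz _ N0)[g Ng g0]] := pselect (N = [set 0]).
  apply: MnE; apply/seteqP; split=> // x cx.
  have [Mp hp] := orth_proj_spec hHb clM cx.
  have : N (x - orth_proj Hb M x) by split=> //; apply: cbB => //; exact: ME.
  by rewrite NN0 => /eqP; rewrite subr_eq0 => /eqP ->.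
apply: Mn0; apply/seteqP; split=> [x Mx|x ->//].
have full : carb `<=` N by apply: reducing_orth_full Ng g0 => // y [_]; exact.
have [cx hx] := full _ (ME _ Mx).
by rewrite (hilbert_def hHb cx)//; exact: hx.
Qed.

End Irreducible.

(** * Completeness of real square-integrable functions *)

Section RieszFischer.
Context d (T : measurableType d) (R : realType) (mu : {measure set T -> \bar R}).

Lemma limn_esup_le_near (u : (\bar R)^nat) (e : \bar R) :
  (\forall n \near \oo, (u n <= e)%E) -> (limn_esup u <= e)%E.
Proof.
move=> [K _ hK]; rewrite limn_esup_lim; apply: lime_le; first exact: is_cvg_esups.
exists K => // n /= Kn; apply: ge_ereal_sup => _ [k /= nk <-].
by apply: hK => /=; exact: leq_trans nk.
Qed.

Lemma cvg_geometric_steps (w : R^nat) (C : R) :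
  (forall k, `|w k.+1 - w k| <= C * 2^-1 ^+ k) -> cvgn w.
Proof.
move=> h; have C0 : 0 <= C by have := h 0%N; rewrite expr0 mulr1; exact: le_trans.
have c : cvgn (series (telescope w)).
  apply: normed_cvg; apply: (@series_le_cvg _ _ (geometric C 2^-1)).
  - by move=> n; exact: normr_ge0.
  - by move=> n; rewrite /geometric /= mulr_ge0// exprn_ge0.
  - by move=> n; exact: h.
  - by apply: is_cvg_geometric_series; rewrite ger0_norm// invf_lt1// ltr1n.
have -> : w = (fun n => w 0%N + series (telescope w) n).
  by apply/funext => n; exact: eq_sum_telescope.
by apply: is_cvgD => //; exact: is_cvg_cst.
Qed.

(** Riesz-Fischer.  Along a subsequence [w] with rapidly decreasing steps, the
    series of [4^k (w_(k+1) - w_k)^2] has finite integral, so almost everywhere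
    [w] has geometrically small steps and converges.  Fatou's lemma bounds the
    distance from the given sequence to the limit. *)
Lemma L2_complete (f : nat -> T -> R) : (forall n, measurable_fun setT (f n)) ->
  (forall e : R, 0 < e -> exists N, forall m n, (N <= m)%N -> (N <= n)%N ->
    (\int[mu]_x ((f m x - f n x) ^+ 2)%:E <= e%:E)%E) ->
  exists g : T -> R, measurable_fun setT g /\ forall e : R, 0 < e ->
    exists N, forall n, (N <= n)%N ->
    (\int[mu]_x ((f n x - g x) ^+ 2)%:E <= e%:E)%E.
Proof.
move=> mf cauchy.
pose e k : R := 1 / (2 ^ k.+1)%:R / 4 ^+ k.
have e0 k : 0 < e k by rewrite /e !divr_gt0// ?exprn_gt0// ltr0n expn_gt0.
have /choice[N hN] := fun k => cauchy _ (e0 k).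
(* The partial sums of [N] dominate [N]; adding [k] to them below makes the
   subsequence go to infinity. *)
pose n_ k := (\sum_(i < k.+1) N i)%N.
have nS k : n_ k.+1 = (n_ k + N k.+1)%N by rewrite /n_ big_ord_recr.
have nN k : (N k <= n_ k)%N by rewrite /n_ big_ord_recr leq_addl.
have nk k : (k <= n_ k + k)%N by rewrite leq_addl.
pose w k := f (n_ k + k)%N.
have mw k : measurable_fun setT (w k) by exact: mf.
have msq (h1 h2 : T -> R) : measurable_fun setT h1 -> measurable_fun setT h2 ->
    measurable_fun setT ((fun x => ((h1 x - h2 x) ^+ 2)%:E) : T -> \bar R).
  move=> m1 m2; apply/measurable_EFinP/measurable_funX.
  exact: measurable_funB.
have wle k : (\int[mu]_x ((w k.+1 x - w k x) ^+ 2)%:E <= (e k)%:E)%E.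
  apply: hN; last exact: leq_trans (nN k) (leq_addr _ _).
  by rewrite nS -addnA; exact: leq_trans (nN k) (leq_addr _ _).
pose g k x := ((4 ^+ k)%:E * ((w k.+1 x - w k x) ^+ 2)%:E)%E.
have mg k : measurable_fun setT (g k).
  by apply: measurable_funeM; exact: msq.
have g0 k x : (0 <= g k x)%E by apply: mule_ge0; rewrite lee_fin; [exact: exprn_ge0|exact: sqr_ge0].
have ig k : (\int[mu]_x g k x <= (1 / (2 ^ k.+1)%:R)%:E)%E.
  have sq0 x : (0 <= ((w k.+1 x - w k x) ^+ 2)%:E)%E by rewrite lee_fin sqr_ge0.
  have p0 : 0 <= 4 ^+ k :> R by rewrite exprn_ge0.
  rewrite /g (ge0_integralZl_EFin _ measurableT (fun x _ => sq0 x) (msq _ _ (mw _) (mw _)) p0).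
  apply: (@le_trans _ _ ((4 ^+ k)%:E * (e k)%:E)%E).
    by apply: lee_wpmul2l => //; rewrite lee_fin exprn_ge0.
  by rewrite -EFinM lee_fin /e mulrC divfK// gt_eqF// exprn_gt0.
pose G x := (\sum_(0 <= k <oo) g k x)%E.
have mG : measurable_fun setT G.
  by apply: (@ge0_emeasurable_sum _ _ _ setT g xpredT) => //.
have iG : (\int[mu]_x G x <= 1%:E)%E.
  rewrite integral_nneseries//; apply: le_trans (epsilon_trick0 xpredT ler01).
  by apply: lee_nneseries => // k _ _; exact: integral_ge0.
have inG : mu.-integrable setT G.
  apply/integrableP; split => //; apply: le_lt_trans (ltry 1).
  apply: le_trans iG; rewrite le_eqVlt; apply/orP; left; apply/eqP.
  by apply: eq_integral => x _; rewrite gee0_abs// nneseries_ge0.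
have cw : {ae mu, forall x, cvgn (w ^~ x)}.
  apply: filterS (integrable_ae measurableT inG) => x /(_ I) Gx.
  apply: (@cvg_geometric_steps _ (Num.sqrt (fine (G x)))) => k.
  have gG : (g k x <= G x)%E.
    apply: le_trans (nneseries_lim_ge k.+1 _) => //.
    by rewrite big_nat_recr//= leeDr// sume_ge0.
  have Gx0 : 0 <= fine (G x) by rewrite fine_ge0// nneseries_ge0.
  move: gG; rewrite -(fineK Gx) /g -EFinM lee_fin => gG.
  rewrite -(@ler_pXn2r _ 2)// ?nnegrE ?mulr_ge0 ?sqrtr_ge0 ?exprn_ge0//.
  rewrite exprMn sqr_sqrtr// real_normK ?num_real//.
  have -> : (2^-1 ^+ k) ^+ 2 = (4 ^+ k)^-1 :> R.
    by rewrite -exprM mulnC exprM -exprVn; congr (_ ^+ k); field.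
  by rewrite ler_pdivlMr ?exprn_gt0// mulrC.
pose W x := fine (limn_esup (fun k => (w k x)%:E)).
have mW : measurable_fun setT W.
  apply: (measurableT_comp (fine_measurable measurableT)).
  by apply: measurable_fun_limn_esup => k; exact/measurable_EFinP.
have wW x : cvgn (w ^~ x) -> w k x @[k --> \oo] --> W x.
  move=> cx; have c : (w k x)%:E @[k --> \oo] --> (limn (w ^~ x))%:E.
    by apply: cvg_EFin => //; exact: nearW.
  by rewrite /W (cvg_limn_einf_sup c).2; exact: cx.
exists W; split=> // r r0; have [K hK] := cauchy r r0; exists K => n Kn.
pose h k x := ((f n x - w k x) ^+ 2)%:E.
have mh k : measurable_fun setT (h k) by exact: msq.
have h0 k x : (0 <= h k x)%E by rewrite lee_fin sqr_ge0.
have -> : (\int[mu]_x ((f n x - W x) ^+ 2)%:E = \int[mu]_x limn_einf (h ^~ x))%E.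
  apply: ge0_ae_eq_integral => //.
  - exact: msq.
  - apply: (@measurableT_comp _ _ _ _ _ _ (-%E) _ (fun x => limn_esup (\- (h ^~ x))%E)) => //.
    by apply: measurable_fun_limn_esup => k; exact: measurableT_comp.
  - by move=> x _; rewrite lee_fin sqr_ge0.
  - move=> x _; rewrite limn_einf_lim; apply: lime_ge; first exact: is_cvg_einfs.
    by apply: nearW => k; apply: le_ereal_inf_tmp => _ [j _ <-].
  - apply: filterS cw => x /wW c _.
    have c2 : h k x @[k --> \oo] --> ((f n x - W x) ^+ 2)%:E.
      by apply: cvg_EFin; [exact: nearW|apply: cvgM; apply: cvgB => //; exact: cvg_cst].
    by rewrite (cvg_limn_einf_sup c2).1.
apply: le_trans (fatou _ _ _ _) _ => //.
apply: le_trans (limn_einf_sup _) _; apply: limn_esup_le_near.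
exists K => // k /= Kk; apply: hK => //.
exact: leq_trans Kk (nk k).
Qed.

End RieszFischer.

(** * Integrals of complex functions *)

Section ComplexIntegral.
Context d (T : measurableType d) (R : realType) (mu : {measure set T -> \bar R}).
Local Notation Re := (@complex.Re R).
Local Notation Im := (@complex.Im R).
Implicit Types f g : T -> R[i].

Definition cintegrable f : Prop :=
  mu.-integrable setT (EFin \o (Re \o f)) /\ mu.-integrable setT (EFin \o (Im \o f)).

Lemma integrable_lin (p q : T -> R) (a : R) : mu.-integrable setT (EFin \o p) ->
  mu.-integrable setT (EFin \o q) -> mu.-integrable setT (EFin \o (fun t => a * p t + q t)).
Proof.
move=> ip iq; have := integrableD measurableT (integrableZl measurableT a ip) iq.
by apply: eq_integrable => // t _ /=; rewrite EFinD EFinM.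
Qed.

Lemma Rintegral_lin (p q : T -> R) (a : R) : mu.-integrable setT (EFin \o p) ->
  mu.-integrable setT (EFin \o q) ->
  \int[mu]_(t in setT) (a * p t + q t) =
  a * (\int[mu]_(t in setT) p t) + \int[mu]_(t in setT) q t.
Proof.
move=> ip iq; rewrite RintegralD//; first by rewrite RintegralZl.
by have := integrableZl measurableT a ip; apply: eq_integrable => // t _ /=; rewrite EFinM.
Qed.

Lemma cintegrableZD (a : R[i]) f g : cintegrable f -> cintegrable g ->
  cintegrable (fun t => a * f t + g t).
Proof.
move=> [f1 f2] [g1 g2]; case: a => a1 a2; split.
- rewrite (_ : _ \o _ = fun t => a1 * Re (f t) + (- a2 * Im (f t) + Re (g t))).
    by apply: integrable_lin => //; exact: integrable_lin.
  by apply/funext => t /=; case: (f t) (g t) => [x y] [z w] /=; ring.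
- rewrite (_ : _ \o _ = fun t => a1 * Im (f t) + (a2 * Re (f t) + Im (g t))).
    by apply: integrable_lin => //; exact: integrable_lin.
  by apply/funext => t /=; case: (f t) (g t) => [x y] [z w] /=; ring.
Qed.

Lemma cintegralZD (a : R[i]) f g : cintegrable f -> cintegrable g ->
  cintegral mu (fun t => a * f t + g t) = a * cintegral mu f + cintegral mu g.
Proof.
move=> [f1 f2] [g1 g2]; case: a => a1 a2; rewrite /cintegral.
rewrite (_ : (fun t => Re _) = fun t => a1 * Re (f t) + (- a2 * Im (f t) + Re (g t))); last first.
  by apply/funext => t /=; case: (f t) (g t) => [x y] [z w] /=; ring.
rewrite (_ : (fun t => Im (_ * _ + _)) =
    fun t => a1 * Im (f t) + (a2 * Re (f t) + Im (g t))); last first.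
  by apply/funext => t /=; case: (f t) (g t) => [x y] [z w] /=; ring.
rewrite !Rintegral_lin//; try exact: integrable_lin.
by apply/eqP; rewrite eq_complex/=; apply/andP; split; apply/eqP; ring.
Qed.

Lemma cintegrable0 : cintegrable (fun=> 0).
Proof. by split; exact: integrable0. Qed.

Lemma cintegral0 : cintegral mu (fun=> 0) = 0.
Proof. by rewrite /cintegral /= /Rintegral integral0. Qed.

Lemma cintegral_conj f : cintegrable f ->
  cintegral mu (fun t => (f t)^*%C) = (cintegral mu f)^*%C.
Proof.
move=> [f1 f2]; rewrite /cintegral/=.
rewrite (_ : (fun t => Re _) = Re \o f); last by apply/funext => t /=; case: (f t).
congr (_ +i* _).
have := Rintegral_lin (-1) f2 (integrable0 mu setT).
rewrite mulN1r [X in _ + X]/Rintegral integral0 addr0 => <-.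
by apply: eq_Rintegral => t _; rewrite /= mulN1r addr0; case: (f t).
Qed.

Lemma cmeasurableM f g : cmeasurable f -> cmeasurable g -> cmeasurable (fun t => f t * g t).
Proof.
move=> [f1 f2] [g1 g2]; split.
- rewrite (_ : _ \o _ = fun t => Re (f t) * Re (g t) - Im (f t) * Im (g t)).
    by apply: measurable_funB; exact: measurable_funM.
  by apply/funext => t /=; case: (f t) (g t) => [x y] [z w].
- rewrite (_ : _ \o _ = fun t => Re (f t) * Im (g t) + Im (f t) * Re (g t)).
    by apply: measurable_funD; exact: measurable_funM.
  by apply/funext => t /=; case: (f t) (g t) => [x y] [z w].
Qed.

Lemma cmeasurableD f g : cmeasurable f -> cmeasurable g -> cmeasurable (fun t => f t + g t).
Proof.
move=> [f1 f2] [g1 g2]; split.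
- rewrite (_ : _ \o _ = fun t => Re (f t) + Re (g t)); first exact: measurable_funD.
  by apply/funext => t /=; case: (f t) (g t) => [x y] [z w].
- rewrite (_ : _ \o _ = fun t => Im (f t) + Im (g t)); first exact: measurable_funD.
  by apply/funext => t /=; case: (f t) (g t) => [x y] [z w].
Qed.

Lemma cmeasurable_conj f : cmeasurable f -> cmeasurable (fun t => (f t)^*%C).
Proof.
move=> [f1 f2]; split.
- by rewrite (_ : _ \o _ = Re \o f)//; apply/funext => t /=; case: (f t).
- rewrite (_ : _ \o _ = fun t => - Im (f t)); first exact: measurableT_comp.
  by apply/funext => t /=; case: (f t).
Qed.

Lemma cmeasurable_cst (c : R[i]) : cmeasurable (fun _ : T => c).
Proof. by split; exact: measurable_cst. Qed.

Lemma cintegrable_measurable f : cintegrable f -> cmeasurable f.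
Proof.
by move=> [/measurable_int/measurable_EFinP f1 /measurable_int/measurable_EFinP f2]; split.
Qed.

Lemma cintegral_ae f g : cmeasurable f -> cmeasurable g ->
  {ae mu, forall t, f t = g t} -> cintegral mu f = cintegral mu g.
Proof.
move=> [f1 f2] [g1 g2] fg; rewrite /cintegral /Rintegral; congr (fine _ +i* fine _).
- apply: ae_eq_integral => //; [exact/measurable_EFinP|exact/measurable_EFinP|].
  by apply: filterS fg => t h _; rewrite h.
- apply: ae_eq_integral => //; [exact/measurable_EFinP|exact/measurable_EFinP|].
  by apply: filterS fg => t h _; rewrite h.
Qed.

(** Dominated convergence for the vanishing of integrals, the only property that is
    passed to the limit below. *)
Lemma cintegral_dominated0 (f_ : nat -> T -> R[i]) f (g : T -> R) :
  (forall n, cintegrable (f_ n)) -> cmeasurable f -> mu.-integrable setT (EFin \o g) ->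
  {ae mu, forall t, Re (f_ n t) @[n --> \oo] --> Re (f t) /\
    Im (f_ n t) @[n --> \oo] --> Im (f t)} ->
  {ae mu, forall t n, `|Re (f_ n t)| <= g t /\ `|Im (f_ n t)| <= g t} ->
  (forall n, cintegral mu (f_ n) = 0) -> cintegral mu f = 0.
Proof.
move=> if_ [mf1 mf2] ig cv dom int0.
have main (Q : R[i] -> R) : (forall n, mu.-integrable setT (EFin \o (Q \o f_ n))) ->
    measurable_fun setT (Q \o f) ->
    {ae mu, forall t, Q (f_ n t) @[n --> \oo] --> Q (f t)} ->
    {ae mu, forall t n, `|Q (f_ n t)| <= g t} ->
    (forall n, \int[mu]_(t in setT) Q (f_ n t) = 0) -> \int[mu]_(t in setT) Q (f t) = 0.
  move=> i1 m2 c dm i0.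
  have [|||_ _ h] := @dominated_convergence _ T R mu setT measurableT
    (fun n => EFin \o (Q \o f_ n)) (EFin \o (Q \o f)) (EFin \o g)
    (fun n => measurable_int _ (i1 n)) _ _ ig.
  - exact/measurable_EFinP.
  - by apply: filterS c => t h _; apply: cvg_EFin => //; exact: nearW.
  - by apply: filterS dm => t h n _ /=; rewrite lee_fin.
  have e : (fun n => \int[mu]_(x in setT) (EFin \o (Q \o f_ n)) x)%E = cst 0%E.
    apply/funext => n; rewrite -[LHS]fineK ?integrable_fin_num//.
    by congr (_%:E); exact: i0.
  move: h => /=; rewrite e => h; rewrite /Rintegral.
  by have := cvg_lim (@ereal_hausdorff R) h; rewrite lim_cst// => <-.
rewrite /cintegral (main Re) ?(main Im)//.
- by move=> n; case: (if_ n).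
- by apply: filterS cv => t [].
- by apply: filterS dom => t h n; case: (h n).
- by move=> n; have [] := int0 n.
- by move=> n; case: (if_ n).
- by apply: filterS cv => t [].
- by apply: filterS dom => t h n; case: (h n).
- by move=> n; have [] := int0 n.
Qed.

End ComplexIntegral.

(** * The Hilbert space of square-integrable complex functions *)

Section L2CSpace.
Local Open Scope quotient_scope.
Context d (T : measurableType d) (R : realType) (mu : {measure set T -> \bar R}).
Local Notation Re := (@complex.Re R).
Local Notation Im := (@complex.Im R).
Local Notation L2C := (L2C mu).
Implicit Types (f g : T -> R[i]) (x y z : L2C).

Lemma Lfun2_sqr_lty (f : T -> R) : measurable_fun setT f ->
  (\int[mu]_t ((f t) ^+ 2)%:E < +oo)%E -> f \in Lfun mu 2%:E.
Proof.
move=> mf fi; rewrite inE; apply/andP; split; rewrite inE//= /finite_norm unlock.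
rewrite poweR_lty//; move: fi; congr (_ < _)%E; apply: eq_integral => t _.
by rewrite /= powR_mulrn// real_normK ?num_real.
Qed.

Lemma Lfun2CP f : f \in Lfun2C mu <-> [/\ cmeasurable f,
   (\int[mu]_t ((Re (f t)) ^+ 2)%:E < +oo)%E & (\int[mu]_t ((Im (f t)) ^+ 2)%:E < +oo)%E].
Proof.
split.
- move=> /andP[f1 f2]; split.
  + by split; [move: f1|move: f2]; rewrite inE => /andP[/[!inE]].
  + by have := Lfun2_integrable_sqr f1 => /integrable_lty; exact.
  + by have := Lfun2_integrable_sqr f2 => /integrable_lty; exact.
- by move=> [[m1 m2] f1 f2]; apply/andP; split; exact: Lfun2_sqr_lty.
Qed.

Lemma Lfun2C_measurable f : f \in Lfun2C mu -> cmeasurable f.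
Proof. by move=> /Lfun2CP[]. Qed.

Lemma Lfun2C_conj f : f \in Lfun2C mu -> (fun t => (f t)^*%C) \in Lfun2C mu.
Proof.
move=> /Lfun2CP[m f1 f2]; apply/Lfun2CP; split; first exact: cmeasurable_conj.
- by move: f1; congr (_ < _)%E; apply: eq_integral => t _; case: (f t).
- by move: f2; congr (_ < _)%E; apply: eq_integral => t _; case: (f t) => a b /=; rewrite sqrrN.
Qed.

Lemma Lfun2C_ZD (a : R[i]) f g : f \in Lfun2C mu -> g \in Lfun2C mu ->
  (fun t => a * f t + g t) \in Lfun2C mu.
Proof. by move=> hf hg; case: (Lfun2C_submod_closed mu) => _; apply. Qed.

Lemma Lfun2C_M f g : f \in Lfun2C mu -> g \in Lfun2C mu -> cintegrable mu (fun t => f t * g t).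
Proof.
move=> /andP[f1 f2] /andP[g1 g2].
have h (p q : T -> R) : p \in Lfun mu 2%:E -> q \in Lfun mu 2%:E ->
    mu.-integrable setT (EFin \o (fun t => p t * q t)).
  by move=> hp hq; apply/Lfun1_integrable; exact: Lfun2_mul_Lfun1.
split.
- rewrite (_ : _ \o _ = fun t => -1 * (Im (f t) * Im (g t)) + Re (f t) * Re (g t)).
    by apply: integrable_lin; exact: h.
  by apply/funext => t /=; case: (f t) (g t) => [x y] [z w] /=; ring.
- rewrite (_ : _ \o _ = fun t => 1 * (Re (f t) * Im (g t)) + Im (f t) * Re (g t)).
    by apply: integrable_lin; exact: h.
  by apply/funext => t /=; case: (f t) (g t) => [x y] [z w] /=; ring.
Qed.

Lemma L2C_fun_in x : L2C_fun x \in Lfun2C mu. Proof. exact: Lfun2C_valP. Qed.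
Lemma L2C_fun_measurable x : cmeasurable (L2C_fun x).
Proof. exact/Lfun2C_measurable/L2C_fun_in. Qed.

Lemma L2C_fun_pi (F : Lfun2CType mu) :
  {ae mu, forall t, L2C_fun (\pi_L2C F) t = F t}.
Proof.
have : repr (\pi_L2C F) - F \in @null2C _ _ _ mu.
  by rewrite Quotient.idealrBE reprK.
move=> /asboolP; apply: filterS => t h.
by apply/eqP; rewrite -subr_eq0; apply/eqP.
Qed.

Lemma L2C_fun_class f : f \in Lfun2C mu -> {ae mu, forall t, L2C_fun (L2C_class mu f) t = f t}.
Proof.
move=> hf; have := L2C_fun_pi (insubd (0 : Lfun2CType mu) f).
by rewrite /L2C_class; apply: filterS => t ->; rewrite insubdK.
Qed.

Lemma L2C_inj x y : {ae mu, forall t, L2C_fun x t = L2C_fun y t} -> x = y.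
Proof.
move=> h; rewrite -[x]reprK -[y]reprK; apply/eqP.
rewrite -Quotient.idealrBE; apply/asboolP; apply: filterS h => t h.
by change (Lfun2C_val (repr x) t - Lfun2C_val (repr y) t = 0); rewrite [X in X - _]h subrr.
Qed.

Lemma L2C_funZD (a : R[i]) x y :
  {ae mu, forall t, L2C_fun (a *: x + y) t = a * L2C_fun x t + L2C_fun y t}.
Proof.
have -> : a *: x + y = \pi_L2C (a *: repr x + repr y).
  by rewrite Quotient.pi_add reprK.
exact: L2C_fun_pi.
Qed.

Lemma L2C_fun0 : {ae mu, forall t, L2C_fun (0 : L2C) t = 0}.
Proof.
have := L2C_funZD (-1) 0 0; rewrite scaleN1r addNr; apply: filterS => t.
by rewrite mulN1r addNr.
Qed.

Lemma L2C_funB x y : {ae mu, forall t, L2C_fun (x - y) t = L2C_fun x t - L2C_fun y t}.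
Proof.
have := L2C_funZD (-1) y x; rewrite scaleN1r addrC; apply: filterS => t ->.
by rewrite mulN1r addrC.
Qed.

Lemma cintegral_aeM f f' g g' : f \in Lfun2C mu -> cmeasurable f' ->
  g \in Lfun2C mu -> cmeasurable g' ->
  {ae mu, forall t, f t = f' t} -> {ae mu, forall t, g t = g' t} ->
  cintegral mu (fun t => f t * g t) = cintegral mu (fun t => f' t * g' t).
Proof.
move=> /Lfun2C_measurable hf hf' /Lfun2C_measurable hg hg' ff gg.
apply: cintegral_ae; [exact: cmeasurableM|exact: cmeasurableM|].
by apply: filterS2 ff gg => t -> ->.
Qed.

Lemma L2C_ip_ae x y f g : cmeasurable f -> cmeasurable g ->
  {ae mu, forall t, L2C_fun x t = f t} -> {ae mu, forall t, L2C_fun y t = g t} ->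
  L2C_ip x y = cintegral mu (fun t => f t * (g t)^*%C).
Proof.
move=> mf mg xf yg; apply: cintegral_aeM => //.
- exact: L2C_fun_in.
- exact/Lfun2C_conj/L2C_fun_in.
- exact: cmeasurable_conj.
- by apply: filterS yg => t ->.
Qed.

Lemma L2C_nsqE x : ((Re (L2C_ip x x))%:E =
  \int[mu]_t ((Re (L2C_fun x t)) ^+ 2)%:E + \int[mu]_t ((Im (L2C_fun x t)) ^+ 2)%:E)%E.
Proof.
have /andP[h1 h2] := L2C_fun_in x.
have i1 := Lfun2_integrable_sqr h1; have i2 := Lfun2_integrable_sqr h2.
rewrite /L2C_ip /cintegral /= -integralD// /Rintegral fineK.
  apply: eq_integral => t _ /=; case: (L2C_fun x t) => a b /=.
  by rewrite -EFinD; congr (_%:E); ring.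
apply: integrable_fin_num => //.
have := integrableD measurableT i1 i2; apply: eq_integrable => // t _ /=.
by case: (L2C_fun x t) => a b /=; rewrite -EFinD; congr (_%:E); ring.
Qed.

Lemma L2C_nsq_ae x f : cmeasurable f -> {ae mu, forall t, L2C_fun x t = f t} ->
  ((Re (L2C_ip x x))%:E =
  \int[mu]_t ((Re (f t)) ^+ 2)%:E + \int[mu]_t ((Im (f t)) ^+ 2)%:E)%E.
Proof.
move=> [m1 m2] xf; have [x1 x2] := L2C_fun_measurable x.
rewrite L2C_nsqE; congr (_ + _)%E; apply: ge0_ae_eq_integral => //.
- by apply/measurable_EFinP; exact: measurable_funX.
- by apply/measurable_EFinP; exact: measurable_funX.
- by move=> t _; rewrite lee_fin sqr_ge0.
- by move=> t _; rewrite lee_fin sqr_ge0.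
- by apply: filterS xf => t ->.
- by apply/measurable_EFinP; exact: measurable_funX.
- by apply/measurable_EFinP; exact: measurable_funX.
- by move=> t _; rewrite lee_fin sqr_ge0.
- by move=> t _; rewrite lee_fin sqr_ge0.
- by apply: filterS xf => t ->.
Qed.

Lemma L2C_nsqBE x y : ((Re (L2C_ip (x - y) (x - y)))%:E =
  \int[mu]_t ((Re (L2C_fun x t) - Re (L2C_fun y t)) ^+ 2)%:E +
  \int[mu]_t ((Im (L2C_fun x t) - Im (L2C_fun y t)) ^+ 2)%:E)%E.
Proof.
rewrite (L2C_nsq_ae _ (L2C_funB x y)).
  by congr (_ + _)%E; apply: eq_integral => t _; rewrite raddfB.
have := cmeasurableD (L2C_fun_measurable x)
  (cmeasurableM (cmeasurable_cst _ (-1)) (L2C_fun_measurable y)).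
by congr cmeasurable; apply/funext => t; rewrite mulN1r.
Qed.

(** Completeness follows from the real case applied to real and imaginary parts. *)
Lemma L2C_hilbert : hilbert (L2C_space mu).
Proof.
split => //=.
- move=> a x y z _ _ _.
  have [mx my mz] := And3 (L2C_fun_measurable x) (L2C_fun_measurable y) (L2C_fun_measurable z).
  rewrite (@L2C_ip_ae _ _ (fun t => a * L2C_fun x t + L2C_fun y t) (L2C_fun z)) //.
  + rewrite -cintegralZD; last 2 first.
    * by apply: Lfun2C_M; [exact: L2C_fun_in|exact/Lfun2C_conj/L2C_fun_in].
    * by apply: Lfun2C_M; [exact: L2C_fun_in|exact/Lfun2C_conj/L2C_fun_in].
    by congr cintegral; apply/funext => t; rewrite mulrDl mulrA.
  + by apply: cmeasurableD => //; apply: cmeasurableM => //; exact: cmeasurable_cst.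
  + exact: L2C_funZD.
  + exact: aeW.
- move=> x y _ _.
  transitivity (cintegral mu (fun t => (L2C_fun x t * (L2C_fun y t)^*%C)^*%C)).
    by congr cintegral; apply/funext => t; rewrite rmorphM/= conjcK mulrC.
  apply: cintegral_conj.
  by apply: Lfun2C_M; [exact: L2C_fun_in|exact/Lfun2C_conj/L2C_fun_in].
- move=> x _; rewrite lecE; apply/andP; split.
    have e : (fun t => Im (L2C_fun x t * (L2C_fun x t)^*%C)) = cst 0.
      by apply/funext => t; case: (L2C_fun x t) => a b /=; ring.
    by rewrite /L2C_ip /cintegral e /= /Rintegral integral0.
  by rewrite -lee_fin L2C_nsqE adde_ge0// integral_ge0// => t _; rewrite lee_fin sqr_ge0.
- move=> x _ h; apply: L2C_inj.
  have := L2C_nsqE x; rewrite h /= => /esym/eqP.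
  have [m1 m2] := L2C_fun_measurable x.
  rewrite padde_eq0; try by apply: integral_ge0 => t _; rewrite lee_fin sqr_ge0.
  move=> /andP[/eqP e1 /eqP e2].
  have z (p : T -> R) : measurable_fun setT p -> (\int[mu]_t (p t ^+ 2)%:E = 0)%E ->
      {ae mu, forall t, p t = 0}.
    move=> mp p0; have mp2 : measurable_fun setT (EFin \o (fun t => p t ^+ 2) : T -> \bar R).
      by apply/measurable_EFinP; exact: measurable_funX.
    have ae0 : ae_eq mu setT (EFin \o (fun t => p t ^+ 2)) (cst 0%E).
      apply/(ae_eq_integral_abs mu measurableT mp2).
      by rewrite -p0; apply: eq_integral => t _; rewrite gee0_abs// lee_fin sqr_ge0.
    by apply: filterS ae0 => t /(_ I) [] /eqP; rewrite sqrf_eq0 => /eqP.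
  apply: filterS3 L2C_fun0 (z _ m1 e1) (z _ m2 e2) => t -> /=.
  by case: (L2C_fun x t) => a b /= -> ->.
- move=> u _ cauchy.
  have nle x e : 0 <= e -> ipnorm (L2C_space mu) x <= Num.sqrt e -> Re (L2C_ip x x) <= e.
    by move=> e0; rewrite ler_sqrt.
  have intsq_ge0 (p : T -> R) : (0 <= \int[mu]_t (p t ^+ 2)%:E)%E.
    by apply: integral_ge0 => t _; rewrite lee_fin sqr_ge0.
  pose has_limit (Q : R[i] -> R) := exists g : T -> R,
    [/\ measurable_fun setT g, g \in Lfun mu 2%:E & forall e : R, 0 < e ->
        exists N, forall n, (N <= n)%N ->
        (\int[mu]_t ((Q (L2C_fun (u n) t) - g t) ^+ 2)%:E <= e%:E)%E].
  have part (Q : R[i] -> R) : (forall x, measurable_fun setT (Q \o L2C_fun x)) ->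
      (forall x, (Q \o L2C_fun x) \in Lfun mu 2%:E) ->
      (forall x y, (\int[mu]_t ((Q (L2C_fun x t) - Q (L2C_fun y t)) ^+ 2)%:E <=
         (Re (L2C_ip (x - y) (x - y)))%:E)%E) ->
      has_limit Q.
    move=> mQ LQ bQ.
    have [//|e e0|g [mg hg]] := @L2_complete _ _ _ mu (fun n => Q \o L2C_fun (u n)).
      have [|N hN] := cauchy (Num.sqrt e); first by rewrite sqrtr_gt0.
      exists N => m n Nm Nn; apply: le_trans (bQ _ _) _; rewrite lee_fin.
      by apply: nle; [exact: ltW|exact: hN].
    exists g; split=> //; have [N /(_ N (leqnn N)) hN] := hg 1 ltr01.
    pose h t := Q (L2C_fun (u N) t) - g t.
    have hL : h \in Lfun mu 2%:E.
      apply: Lfun2_sqr_lty; first exact: measurable_funB (mQ (u N)) mg.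
      exact: le_lt_trans hN (ltry _).
    have -> : g = (-1 : R) *: h + (Q \o L2C_fun (u N)).
      by apply/funext => t; rewrite fctE /h /= scaleN1r opprB addrNK.
    have h1 : (1 <= 2%:E :> \bar R)%E by rewrite lee_fin ler1n.
    by have [_] := Lfun_submod_closed mu h1; apply.
  have [g1 [mg1 Lg1 hg1]] : has_limit Re.
    apply: part => [x|x|x y]; first by case: (L2C_fun_measurable x).
      by case/andP: (L2C_fun_in x).
    by rewrite L2C_nsqBE leeDl.
  have [g2 [mg2 Lg2 hg2]] : has_limit Im.
    apply: part => [x|x|x y]; first by case: (L2C_fun_measurable x).
      by case/andP: (L2C_fun_in x).
    by rewrite L2C_nsqBE leeDr.
  pose f t := g1 t +i* g2 t.
  have fL : f \in Lfun2C mu by apply/andP; split.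
  have mf : cmeasurable f by split.
  exists (L2C_class mu f) => //; apply/cvgrPdist_le => e e0.
  have e2 : 0 < e ^+ 2 / 2 by rewrite divr_gt0// exprn_gt0.
  have [N1 hN1] := hg1 _ e2; have [N2 hN2] := hg2 _ e2.
  exists (maxn N1 N2) => // n /=; rewrite geq_max => /andP[n1 n2].
  rewrite sub0r normrN ger0_norm ?sqrtr_ge0// -[e]ger0_norm ?(ltW e0)// -sqrtr_sqr.
  rewrite ler_wsqrtr// -lee_fin (L2C_nsq_ae (f := fun t => L2C_fun (u n) t - f t)).
  + have -> : e ^+ 2 = e ^+ 2 / 2 + e ^+ 2 / 2 by rewrite -splitr.
    rewrite EFinD; apply: leeD.
      apply: le_trans (hN1 _ n1); rewrite le_eqVlt; apply/orP; left; apply/eqP.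
      by apply: eq_integral => t _; rewrite raddfB.
    apply: le_trans (hN2 _ n2); rewrite le_eqVlt; apply/orP; left; apply/eqP.
    by apply: eq_integral => t _; rewrite raddfB.
  + have := cmeasurableD (L2C_fun_measurable (u n)) (cmeasurableM (cmeasurable_cst _ (-1)) mf).
    by congr cmeasurable; apply/funext => t; rewrite mulN1r.
  + by apply: filterS2 (L2C_funB (u n) (L2C_class mu f)) (L2C_fun_class fL) => t -> ->.
Qed.

End L2CSpace.

(** * Multiplication operators *)

Section Multipliers.
Context d (T : measurableType d) (R : realType) (mu : {measure set T -> \bar R}).
Local Notation Re := (@complex.Re R).
Local Notation Im := (@complex.Im R).
Local Notation L2C := (L2C mu).
Implicit Types (phi psi : T -> R[i]) (x y z : L2C).

Definition contractive_symbol phi : Prop :=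
  cmeasurable phi /\ {ae mu, forall t, Re (phi t) ^+ 2 + Im (phi t) ^+ 2 <= 1}.

Definition mulop phi x : L2C := L2C_class mu (fun t => phi t * L2C_fun x t).

Lemma contractive_symbol_conj phi : contractive_symbol phi ->
  contractive_symbol (fun t => (phi t)^*%C).
Proof.
move=> [m b]; split; first exact: cmeasurable_conj.
by apply: filterS b => t; case: (phi t) => p q /=; rewrite sqrrN.
Qed.

Lemma mul_Lfun2C phi (f : T -> R[i]) : contractive_symbol phi -> f \in Lfun2C mu ->
  (fun t => phi t * f t) \in Lfun2C mu.
Proof.
move=> [mp bp] hf; have [mf f1 f2] := (Lfun2CP _ _).1 hf; have [mf1 mf2] := mf.
have [mg1 mg2] := cmeasurableM mp mf.
have m2 (p : T -> R) : measurable_fun setT p ->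
    measurable_fun setT (EFin \o (fun t => p t ^+ 2) : T -> \bar R).
  by move=> h; apply/measurable_EFinP; exact: measurable_funX.
have fin : (\int[mu]_t ((Re (f t)) ^+ 2 + (Im (f t)) ^+ 2)%:E < +oo)%E.
  under eq_integral do rewrite EFinD.
  rewrite ge0_integralD//; [exact: lte_add_pinfty|by move=> t _; rewrite lee_fin sqr_ge0| |
     by move=> t _; rewrite lee_fin sqr_ge0|]; exact: m2.
have m3 : measurable_fun setT (EFin \o (fun t => Re (f t) ^+ 2 + Im (f t) ^+ 2) : T -> \bar R).
  by apply/measurable_EFinP; apply: measurable_funD; exact: measurable_funX.
have bound (p : T -> R) : measurable_fun setT p ->
    {ae mu, forall t, p t ^+ 2 <= Re (f t) ^+ 2 + Im (f t) ^+ 2} ->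
    (\int[mu]_t (p t ^+ 2)%:E < +oo)%E.
  move=> mq pf; apply: le_lt_trans fin; apply: ae_ge0_le_integral => //.
  - by move=> t _; rewrite lee_fin sqr_ge0.
  - exact: m2.
  - by move=> t _; rewrite lee_fin addr_ge0 ?sqr_ge0.
  - by apply: filterS pf => t h _; rewrite lee_fin.
have prod (p q p' q' : R) : p ^+ 2 + q ^+ 2 <= 1 ->
    (p ^+ 2 + q ^+ 2) * (p' ^+ 2 + q' ^+ 2) <= p' ^+ 2 + q' ^+ 2.
  by move=> h; apply: ler_piMl => //; rewrite addr_ge0 ?sqr_ge0.
apply/Lfun2CP; split; first exact: cmeasurableM.
- apply: (bound _ mg1); apply: filterS bp => t /=.
  case: (phi t) (f t) => [p q] [p' q'] /= /(prod _ _ p' q').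
  have := sqr_ge0 (p * q' + q * p'); nra.
- apply: (bound _ mg2); apply: filterS bp => t /=.
  case: (phi t) (f t) => [p q] [p' q'] /= /(prod _ _ p' q').
  have := sqr_ge0 (p * p' - q * q'); nra.
Qed.

Lemma mulop_fun phi x : contractive_symbol phi ->
  {ae mu, forall t, L2C_fun (mulop phi x) t = phi t * L2C_fun x t}.
Proof. by move=> hp; apply: L2C_fun_class; apply: mul_Lfun2C => //; exact: L2C_fun_in. Qed.

Lemma mulop_adj phi x y : contractive_symbol phi ->
  L2C_ip (mulop phi x) y = L2C_ip x (mulop (fun t => (phi t)^*%C) y).
Proof.
move=> hp; have hpc := contractive_symbol_conj hp.
have [mx my] := (L2C_fun_measurable x, L2C_fun_measurable y).
rewrite (L2C_ip_ae _ my (mulop_fun x hp)); [|by apply: cmeasurableM => //; case: hp|exact: aeW].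
rewrite (L2C_ip_ae mx _ _ (mulop_fun y hpc)); [|by apply: cmeasurableM => //; case: hpc|exact: aeW].
by congr cintegral; apply/funext => t; rewrite rmorphM/= conjcK; ring.
Qed.

Lemma mulop_comp_fun phi psi x : contractive_symbol phi -> contractive_symbol psi ->
  {ae mu, forall t, L2C_fun (mulop phi (mulop psi x)) t = phi t * (psi t * L2C_fun x t)}.
Proof.
by move=> hp hq; apply: filterS2 (mulop_fun (mulop psi x) hp) (mulop_fun x hq) => t -> ->.
Qed.

Lemma mulopC phi psi x : contractive_symbol phi -> contractive_symbol psi ->
  mulop phi (mulop psi x) = mulop psi (mulop phi x).
Proof.
move=> hp hq; apply: L2C_inj.
by apply: filterS2 (mulop_comp_fun x hp hq) (mulop_comp_fun x hq hp) => t -> ->; ring.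
Qed.

End Multipliers.

(** * The unit circle *)

Section Circle.
Context (R : realType).
Local Notation Re := (@complex.Re R).
Local Notation Im := (@complex.Im R).
Local Notation arc := (@Defs.arc R).
Local Notation leb := (@lebesgue_measure R).

Lemma arc_integral_ge0 (f : R -> R) : measurable_fun setT f -> (forall t, 0 <= f t) ->
  (\int[arc]_t (f t)%:E = ((2 * pi)^-1)%:E * \int[leb]_(t in [set` `[0, 2 * pi]%R]) (f t)%:E)%E.
Proof.
move=> mf f0; rewrite /Defs.arc integral_uniform ?subr0//; exact/measurable_EFinP.
Qed.

Lemma arc_integrable_bounded (f : R -> R) (M : R) : measurable_fun setT f ->
  (forall t, `|f t| <= M) -> arc.-integrable setT (EFin \o f).
Proof.
move=> mf fM; apply: measurable_bounded_integrable => //.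
  by rewrite (le_lt_trans (probability_le1 arc measurableT))// ltry.
exists M; split; first exact: num_real.
by move=> x Mx t _ /=; apply: le_trans (fM t) (ltW Mx).
Qed.

Lemma cis_exp (t : R) n : cis t ^+ n = cos (n%:R * t) +i* sin (n%:R * t).
Proof.
elim: n => [|n IH]; first by rewrite expr0 mul0r cos0 sin0.
rewrite exprSr IH -natr1 mulrDl mul1r cosD sinD /cis.
by apply/eqP; rewrite eq_complex/=; apply/andP; split; apply/eqP; ring.
Qed.

Lemma cisE (t : R) : Re (cis t) ^+ 2 + Im (cis t) ^+ 2 = 1.
Proof. exact: cos2Dsin2. Qed.

Lemma cisJ (t : R) : (cis t)^*%C * cis t = 1.
Proof.
rewrite /cis; apply/eqP; rewrite eq_complex/=; apply/andP; split; apply/eqP; last by ring.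
by rewrite -[RHS](cos2Dsin2 t); ring.
Qed.

Lemma cmeasurable_cis : cmeasurable (@cis R).
Proof.
by split; apply: continuous_measurable_fun; [exact: continuous_cos|exact: continuous_sin].
Qed.

Lemma cmeasurable_cisX n : cmeasurable (fun t : R => cis t ^+ n).
Proof.
elim: n => [|n IH]; first by under eq_fun do rewrite expr0; exact: cmeasurable_cst.
by under eq_fun do rewrite exprS; apply: cmeasurableM => //; exact: cmeasurable_cis.
Qed.

Lemma bounded_cisX n : contractive_symbol arc (fun t => cis t ^+ n).
Proof.
split; first exact: cmeasurable_cisX.
by apply: aeW => t; rewrite cis_exp cos2Dsin2.
Qed.

Lemma bounded_cis : contractive_symbol arc (@cis R).
Proof. by split; [exact: cmeasurable_cis|apply: aeW => t; rewrite cisE]. Qed.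

Lemma arc_setT : arc setT = 1%E.
Proof. exact: (probability_setT (uniform_prob (@twopi_gt0 R))). Qed.

Lemma arc_integral1 : \int[arc]_(t in setT) (1 : R) = 1.
Proof. by rewrite Rintegral_cst// [X in fine X]arc_setT mulr1. Qed.

(** Integrate [1 + f >= 0], whose primitive [t + g t] grows by [2 pi] over a period;
    adding 1 makes the integral that of a nonnegative function. *)
Lemma arc_integral_derivative (f g : R -> R) : continuous f ->
  (forall t, -1 <= f t <= 1) -> (forall t : R, is_derive t (1 : R) g (f t)) -> g (2 * pi) = g 0 ->
  \int[arc]_(t in setT) f t = 0.
Proof.
move=> cf fb dg gper.
have mf : measurable_fun setT f := continuous_measurable_fun cf.
have pi2_gt0 : (0 : R) < 2 * pi by exact: twopi_gt0.
have f1 t : 0 <= 1 + f t by have /andP[] := fb t; lra.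
have if_ : arc.-integrable setT (EFin \o f).
  by apply: (@arc_integrable_bounded _ 1) => // t; rewrite ler_norml.
have i1 : arc.-integrable setT (EFin \o (fun=> 1 : R)).
  by apply: (@arc_integrable_bounded _ 1) => // t; rewrite normr1.
have dF (t : R) : is_derive t (1 : R) (fun t : R => t + g t) (1 + f t).
  exact: is_deriveD (is_derive_id t 1) (dg t).
suff : \int[arc]_(t in setT) (1 + f t) = 1.
  by rewrite RintegralD// arc_integral1 => /eqP; rewrite -subr_eq0 addrC addKr => /eqP.
rewrite /Rintegral arc_integral_ge0//; last exact: measurable_funD.
rewrite (@continuous_FTC2 _ _ (fun t => t + g t))//.
- rewrite gper add0r -EFinB -EFinM /= addrK mulVf// gt_eqF//.
- apply: continuous_subspaceT => t; apply: cvgD; [exact: cvg_cst|exact: cf].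
- have cF t : {for t, continuous (fun t => t + g t)}.
    by apply: differentiable_continuous; apply/derivable1_diffP; case: (dF t).
  split; first by move=> t _; case: (dF t).
  - exact/cvg_at_right_filter/cF.
  - exact/cvg_at_left_filter/cF.
- by move=> t _; rewrite derive1E; exact: derive_val.
Qed.

Lemma cis_period : cis (2 * pi) = 1 :> R[i].
Proof. by rewrite /cis mulr_natl cos2pi sin2pi. Qed.

Let sin_period n : sin (n%:R * (2 * pi)) = 0 :> R.
Proof. by have := cis_exp (2 * pi) n; rewrite cis_period expr1n => -[]. Qed.

Let cos_period n : cos (n%:R * (2 * pi)) = 1 :> R.
Proof. by have := cis_exp (2 * pi) n; rewrite cis_period expr1n => -[]. Qed.

Lemma cintegral_cisX n : (0 < n)%N -> cintegral arc (fun t => cis t ^+ n) = 0.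
Proof.
move=> n0; have n0' : n%:R != 0 :> R by rewrite pnatr_eq0 -lt0n.
rewrite /cintegral; apply/eqP; rewrite eq_complex/=; apply/andP; split; apply/eqP.
- under eq_Rintegral do rewrite cis_exp/=.
  apply: (@arc_integral_derivative _ (fun t => n%:R^-1 * sin (n%:R * t))).
  + by move=> t; apply: continuous_comp; [exact: mulrl_continuous|exact: continuous_cos].
  + by move=> t; rewrite cos_geN1 cos_le1.
  + move=> t; have dn := is_deriveZ n%:R (is_derive_id t (1 : R)).
    have h := is_deriveZ n%:R^-1 (is_derive1_comp (is_derive_sin (n%:R * t)) dn).
    by apply: (is_derive_eq h); rewrite -[LHS]/(_ * (_ * (_ * _))) mulr1 mulrCA mulVf ?mulr1.
  + by rewrite mulr0 sin0 sin_period.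
- under eq_Rintegral do rewrite cis_exp/=.
  apply: (@arc_integral_derivative _ (fun t => - n%:R^-1 * cos (n%:R * t))).
  + by move=> t; apply: continuous_comp; [exact: mulrl_continuous|exact: continuous_sin].
  + by move=> t; rewrite sin_geN1 sin_le1.
  + move=> t; have dn := is_deriveZ n%:R (is_derive_id t (1 : R)).
    have h := is_deriveZ (- n%:R^-1) (is_derive1_comp (is_derive_cos (n%:R * t)) dn).
    apply: (is_derive_eq h); rewrite -[LHS]/(_ * (_ * (_ * _))) mulr1.
    by rewrite mulNr mulNr mulrN opprK mulrCA mulVf ?mulr1.
  + by rewrite mulr0 cos0 cos_period.
Qed.

End Circle.

#[local] Instance arc_ae_filter (R : realType) : Filter (nbhs (almost_everywhere (@Defs.arc R))).
Proof. exact: (ae_filter_ringOfSetsType (uniform_prob (@twopi_gt0 R))). Qed.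

(** * Uniqueness of Fourier coefficients *)

Section SteepPolynomials.
Context (R : realType).
Implicit Types v : R.

(** A polynomial of degree increasing with [n] that is close to 1 for [v < 1/2] and
    to 0 for [v > 1/2]: by Bernoulli's inequality the threshold is where
    [2^n v^n] passes from small to large values. *)
Definition steep (n : nat) v : R := (1 - v ^+ n) ^+ (2 ^ n).

Lemma bernoulli_le (y : R) N : 0 <= y <= 1 -> 1 - N%:R * y <= (1 - y) ^+ N.
Proof.
move=> /andP[y0 y1]; elim: N => [|N IH]; first by rewrite mul0r subr0 expr0.
rewrite exprS -natr1; apply: le_trans (ler_wpM2l _ IH); last by rewrite subr_ge0.
have : 0 <= N%:R :> R by []. 
move: (N%:R) => k k0; nra.
Qed.

Lemma bernoulli_ge (y : R) N : 0 <= y -> 1 + N%:R * y <= (1 + y) ^+ N.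
Proof.
move=> y0; elim: N => [|N IH]; first by rewrite mul0r addr0 expr0.
rewrite exprS -natr1; apply: le_trans (ler_wpM2l _ IH); last by rewrite addr_ge0.
have : 0 <= N%:R :> R by []. 
move: (N%:R) => k k0; nra.
Qed.

Lemma steep_itv n v : 0 <= v <= 1 -> 0 <= steep n v <= 1.
Proof.
move=> /andP[v0 v1]; have h : 0 <= 1 - v ^+ n by rewrite subr_ge0 exprn_ile1.
by rewrite /steep exprn_ge0//= exprn_ile1// lerBlDr lerDl exprn_ge0.
Qed.

Lemma steep_cvg1 v : 0 <= v < 2^-1 -> steep n v @[n --> \oo] --> (1 : R).
Proof.
move=> /andP[v0 v2]; have v1 : v <= 1 by lra.
have q1 : `|2 * v| < 1 by rewrite ger0_norm ?mulr_ge0//; lra.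
apply: (@squeeze_cvgr _ _ _ _ (fun n => 1 - (2 * v) ^+ n) (fun=> 1)).
- apply: nearW => n; have vv : 0 <= v <= 1 by rewrite v0.
  have /andP[_ ->] := steep_itv n vv; rewrite andbT exprMn -natrX; apply: bernoulli_le.
  by rewrite exprn_ge0//= exprn_ile1.
- rewrite -[X in _ --> X]subr0; apply: cvgB; first exact: cvg_cst.
  exact: cvg_expr.
- exact: cvg_cst.
Qed.

(** Use [(1 - y)^N (1 + y)^N <= 1] and Bernoulli's inequality for the second
    factor, with [y = v^n] and [N = 2^n]. *)
Lemma steep_cvg0 v : 2^-1 < v <= 1 -> steep n v @[n --> \oo] --> (0 : R).
Proof.
move=> /andP[v2 v1]; have v0 : 0 <= v by lra.
have q1 : `|(2 * v)^-1| < 1 by rewrite ger0_norm ?invr_ge0 ?mulr_ge0// invf_lt1; lra.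
apply: (@squeeze_cvgr _ _ _ _ (fun=> 0) (fun n => (2 * v)^-1 ^+ n)).
- apply: nearW => n; have vv : 0 <= v <= 1 by rewrite v0.
  have /andP[s0 s1] := steep_itv n vv; rewrite s0 exprVn exprMn -natrX/=.
  have vn0 : 0 < v ^+ n by rewrite exprn_gt0//; lra.
  rewrite -[_^-1]mul1r ler_pdivlMr ?mulr_gt0 ?ltr0n ?expn_gt0//.
  have h := @bernoulli_ge (v ^+ n) (2 ^ n) (ltW vn0).
  apply: (@le_trans _ _ (steep n v * (1 + v ^+ n) ^+ (2 ^ n))).
    by apply: ler_wpM2l => //; apply: le_trans h; rewrite lerDr.
  rewrite /steep -exprMn -subr_sqr expr1n exprn_ile1 ?subr_ge0 ?exprn_ile1//.
  - by rewrite exprn_ge0.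
  - by rewrite lerBlDr lerDl !exprn_ge0.
- exact: cvg_cst.
- exact: cvg_expr.
Qed.

End SteepPolynomials.

Section FourierUniqueness.
Context (R : realType).
Local Notation Re := (@complex.Re R).
Local Notation Im := (@complex.Im R).
Local Notation arc := (@Defs.arc R).
Local Notation leb := (@lebesgue_measure R).

(** The formula for nonnegative functions extends to [h] by writing [h] as the
    difference of [|h| + h] and [|h|]. *)
Lemma arc_Rintegral (h : R -> R) : arc.-integrable setT (EFin \o h) ->
  leb.-integrable [set` `[0, 2 * pi]%R] (EFin \o h) /\
  \int[arc]_(t in setT) h t = (2 * pi)^-1 * \int[leb]_(t in [set` `[0, 2 * pi]%R]) h t.
Proof.
move=> ih; have /integrableP[mh' _] := ih.
have mh : measurable_fun setT h by exact/measurable_EFinP.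
have p0 : 0 < (2 * pi)^-1 :> R by rewrite invr_gt0; exact: twopi_gt0.
have ia : arc.-integrable setT (EFin \o (fun t => `|h t|)) by exact: (integrable_norm ih).
have mn : measurable_fun setT (fun t => `|h t|) by exact: measurableT_comp.

have ge0 t : 0 <= `|h t| + h t by have := ler_norm (- h t); rewrite normrN; lra.
have e1 := arc_integral_ge0 mn (fun t => normr_ge0 _).
have e2 := arc_integral_ge0 (measurable_funD mn mh) ge0.
have il : leb.-integrable [set` `[0, 2 * pi]%R] (EFin \o h).
  apply/integrableP; split; first by apply/measurable_EFinP; exact: measurable_funTS.
  have := integrable_fin_num measurableT ia; rewrite e1 ltey => fn.
  by apply/eqP => hoo; move: fn; rewrite hoo mulry gtr0_sg// mul1e.
have iln : leb.-integrable [set` `[0, 2 * pi]%R] (EFin \o (fun t => `|h t|)).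
  exact: (integrable_norm il).
split=> //.
have -> : \int[arc]_(t in setT) h t =
    \int[arc]_(t in setT) (`|h t| + h t) - \int[arc]_(t in setT) `|h t|.
  by rewrite RintegralD// addrAC subrr add0r.
have f1 : (\int[leb]_(t in [set` `[0, 2 * pi]%R]) `|h t|%:E)%E \is a fin_num.
  by apply: integrable_fin_num => //; exact: iln.
have f2 : (\int[leb]_(t in [set` `[0, 2 * pi]%R]) (`|h t| + h t)%:E)%E \is a fin_num.
  apply: integrable_fin_num => //.
  by apply: (integrableD _ iln il).
rewrite /Rintegral e1 e2 !fineM// -mulrBr; congr (_ * _).
by rewrite -/(Rintegral _ _ _) -/(Rintegral _ _ _) RintegralD// addrAC subrr add0r.
Qed.

Implicit Types (F w : R -> R[i]).

(** All Fourier coefficients of [F] vanish; square integrability is part of the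
    notion so that products with bounded functions stay integrable. *)
Definition fourier_null F : Prop := F \in Lfun2C arc /\ forall n,
  cintegral arc (fun t => F t * cis t ^+ n) = 0 /\
  cintegral arc (fun t => F t * (cis t ^+ n)^*%C) = 0.

(** The set of these multipliers is an algebra; containing [cis] and its conjugate,
    it contains every trigonometric polynomial. *)
Definition null_mult w : Prop := forall F, fourier_null F -> fourier_null (fun t => w t * F t).

Lemma Lfun2C_cst (c : R[i]) : (fun=> c) \in Lfun2C arc.
Proof. by apply/andP; split; exact: (Lfun_cst (uniform_prob (@twopi_gt0 R))). Qed.

Lemma Lfun2C_integrable F : F \in Lfun2C arc -> cintegrable arc F.
Proof.
move=> hF; have := Lfun2C_M hF (Lfun2C_cst 1).
by under eq_fun do rewrite mulr1.
Qed.

Lemma Lfun2C_cisX F n : F \in Lfun2C arc -> (fun t => F t * cis t ^+ n) \in Lfun2C arc.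
Proof.
move=> hF; have := mul_Lfun2C (bounded_cisX R n) hF.
by under eq_fun do rewrite mulrC.
Qed.

Lemma Lfun2C_cisXC F n : F \in Lfun2C arc -> (fun t => F t * (cis t ^+ n)^*%C) \in Lfun2C arc.
Proof.
move=> hF; have := mul_Lfun2C (contractive_symbol_conj (bounded_cisX R n)) hF.
by under eq_fun do rewrite mulrC.
Qed.

Lemma cisCX (t : R) n : (cis t ^+ n)^*%C = (cis t)^*%C ^+ n.
Proof. by rewrite rmorphXn. Qed.

Lemma null_mult_cis : null_mult (@cis R).
Proof.
move=> F [FL hF]; split; first exact: (mul_Lfun2C (bounded_cis R) FL).
move=> n; split.
  have [<- _] := hF n.+1; congr cintegral; apply/funext => t.
  by rewrite exprS; ring.
case: n => [|n].
  have [<- _] := hF 1%N; congr cintegral; apply/funext => t.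
  by rewrite expr0 rmorph1 expr1; ring.
have [_ <-] := hF n; congr cintegral; apply/funext => t.
by rewrite !cisCX exprS -[RHS]mulr1 -(cisJ t); ring.
Qed.

Lemma null_mult_cisC : null_mult (fun t => (cis t)^*%C).
Proof.
move=> F [FL hF]; split; first exact: (mul_Lfun2C (contractive_symbol_conj (bounded_cis R)) FL).
move=> n; split; last first.
  have [_ <-] := hF n.+1; congr cintegral; apply/funext => t.
  by rewrite !cisCX exprS; ring.
case: n => [|n].
  have [_ <-] := hF 1%N; congr cintegral; apply/funext => t.
  by rewrite expr0 expr1; ring.
have [<- _] := hF n; congr cintegral; apply/funext => t.
by rewrite exprS -[RHS]mulr1 -(cisJ t); ring.
Qed.

Lemma null_multZD (a : R[i]) w1 w2 : null_mult w1 -> null_mult w2 ->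
  null_mult (fun t => a * w1 t + w2 t).
Proof.
move=> p1 p2 F hF; have [L1 h1] := p1 _ hF; have [L2 h2] := p2 _ hF.
have e : (fun t => (a * w1 t + w2 t) * F t) = fun t => a * (w1 t * F t) + w2 t * F t.
  by apply/funext => t; ring.
rewrite e; split; first exact: Lfun2C_ZD.
move=> n; have [h11 h12] := h1 n; have [h21 h22] := h2 n; split.
- transitivity (cintegral arc (fun t => a * (w1 t * F t * cis t ^+ n) + w2 t * F t * cis t ^+ n)).
    by congr cintegral; apply/funext => t; ring.
  by rewrite cintegralZD ?h11 ?h21 ?mulr0 ?addr0//; apply: Lfun2C_integrable; exact: Lfun2C_cisX.
- transitivity (cintegral arc
    (fun t => a * (w1 t * F t * (cis t ^+ n)^*%C) + w2 t * F t * (cis t ^+ n)^*%C)).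
    by congr cintegral; apply/funext => t; ring.
  by rewrite cintegralZD ?h12 ?h22 ?mulr0 ?addr0//; apply: Lfun2C_integrable; exact: Lfun2C_cisXC.
Qed.

Lemma null_mult1 : null_mult (fun=> 1).
Proof. by move=> F; under [X in _ -> fourier_null X]eq_fun do rewrite mul1r. Qed.

Lemma null_multM w1 w2 : null_mult w1 -> null_mult w2 -> null_mult (fun t => w1 t * w2 t).
Proof.
by move=> p1 p2 F hF; under eq_fun do rewrite -mulrA; apply: p1; exact: p2.
Qed.

Lemma null_multX w n : null_mult w -> null_mult (fun t => w t ^+ n).
Proof.
move=> p; elim: n => [|n IH]; first by under eq_fun do rewrite expr0; exact: null_mult1.
by under eq_fun do rewrite exprS; exact: null_multM.
Qed.

Lemma null_multZ (a : R[i]) w : null_mult w -> null_mult (fun t => a * w t).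
Proof.
move=> p; have := null_multZD a p (null_multZD (-1) null_mult1 null_mult1).
by under eq_fun do rewrite mulr1 addNr addr0.
Qed.

Lemma null_mult_cos (m : R) : null_mult (fun t => (cos (t - m))%:C).
Proof.
have -> : (fun t => (cos (t - m))%:C) =
    fun t => (2^-1 *: (cis m)^*%C) * cis t + (2^-1 *: cis m) * (cis t)^*%C.
  apply/funext => t; rewrite cosB /cis; apply/eqP; rewrite eq_complex/=.
  by apply/andP; split; apply/eqP; field.
by apply: null_multZD; [exact: null_mult_cis|apply: null_multZ; exact: null_mult_cisC].
Qed.

(** For [c] in [[-1, 1]], the affine function of [cos (t - m)] fed to [steep] takes
    values in [[0, 1]], and it is below [1/2] exactly when [cos (t - m) > c]. *)
Definition steep_arc (m c : R) n (t : R) := steep n (2^-1 - (cos (t - m) - c) / 4).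

Lemma null_mult_steep (m c : R) n : null_mult (fun t => (steep_arc m c n t)%:C).
Proof.
pose v t : R[i] := (2^-1 - (cos (t - m) - c) / 4)%:C.
have pv : null_mult v.
  have -> : v = fun t => (- (4^-1)%:C) * (cos (t - m))%:C + (2^-1 + c / 4)%:C * 1.
    by apply/funext => t; rewrite mulr1 -rmorphN -rmorphM -rmorphD/=; congr (_%:C); field.
  by apply: null_multZD; [exact: null_mult_cos|exact: null_multZ null_mult1].
have -> : (fun t => (steep_arc m c n t)%:C) = fun t => ((-1) * v t ^+ n + 1) ^+ (2 ^ n).
  by apply/funext => t; rewrite /steep_arc /steep rmorphXn rmorphB rmorph1 rmorphXn mulN1r addrC.
by apply: null_multX; apply: null_multZD; [exact: null_multX|exact: null_mult1].
Qed.

Lemma arc_ae_lebesgue (P : R -> Prop) : {ae leb, forall t, P t} -> {ae arc, forall t, P t}.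
Proof.
move=> [N [mN N0 PN]]; exists N; split=> //.
exact: (null_content_dominatesP _ _).1 (dominates_uniform_prob (@twopi_gt0 R)) N mN N0.
Qed.

Lemma arc_ae_itv : {ae arc, forall t, 0 <= t <= 2 * pi}.
Proof.
exists (~` [set` `[0, 2 * pi]%R]); split.
- by apply: measurableC; exact: measurable_itv.
- rewrite /Defs.arc /uniform_prob integral_uniform_pdf setICl; exact: integral_set0.
- by move=> t /= h; rewrite in_itv.
Qed.

Lemma arc_ae_neq (a : R) : {ae arc, forall t, t != a}.
Proof.
apply: arc_ae_lebesgue; exists [set a]; split => //; first exact: lebesgue_measure_set1.
by move=> t /= /negP; rewrite negbK => /eqP.
Qed.

Lemma cos_dist_gt (s r : R) : 0 < r < pi -> `|s| < r -> cos r < cos s.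
Proof.
move=> /andP[r0 rp] sr; have -> : cos s = cos `|s|.
  by case: ger0P => _; rewrite ?cosN.
by rewrite ltr_cos// in_itv/= ?normr_ge0 ?(ltW r0) ?(ltW rp) ?(ltW (lt_trans sr rp)).
Qed.

Lemma cos_dist_lt (s r : R) : 0 < r < pi -> r < `|s| < 2 * pi - r -> cos s < cos r.
Proof.
move=> /andP[r0 rp] /andP[rs sr]; have -> : cos s = cos `|s|.
  by case: ger0P => _; rewrite ?cosN.
move: rs sr; move: `|s| => {}s rs sr.
have [sp|sp] := lerP s pi.
  by rewrite ltr_cos// in_itv/= ?(ltW r0) ?(ltW rp) ?sp ?(ltW (lt_trans r0 rs)).
have -> : cos s = cos (2 * pi - s).
  by rewrite -[RHS]cosN opprB mulr_natl -(cosD2pi (s - pi *+ 2)) addrNK.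
by rewrite ltr_cos// ?in_itv/=; lra.
Qed.

Lemma steep_arc_itv (m r t : R) n : 0 <= steep_arc m (cos r) n t <= 1.
Proof.
apply: steep_itv; have := cos_geN1 r; have := cos_le1 r.
have := cos_geN1 (t - m); have := cos_le1 (t - m); lra.
Qed.

(** On the arc the cosine of [t - m] exceeds [cos r], off the arc it is smaller; the
    two end points, where it is equal, are excluded. *)
Lemma steep_arc_cvg (m r t : R) : 0 < r < pi -> 0 < m - r -> m + r < 2 * pi ->
  0 <= t <= 2 * pi -> t != m - r -> t != m + r ->
  steep_arc m (cos r) n t @[n --> \oo] --> (\1_(ball m r) t : R).
Proof.
move=> rp mr1 mr2 /andP[t0 t2] tn1 tn2; have /andP[r0 _] := rp.
have b1 := cos_geN1 r; have b2 := cos_le1 r.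
have b3 := cos_geN1 (t - m); have b4 := cos_le1 (t - m).
rewrite indicE; have [tr|tr] := boolP (t \in (ball m r : set R)).
  apply: steep_cvg1; move: tr; rewrite inE -ball_normE/= distrC => tr.
  by have := cos_dist_gt rp tr; lra.
apply: steep_cvg0; move: tr; rewrite notin_setE -ball_normE/= distrC => /negP; rewrite -leNgt => tr.
have tr' : r < `|t - m|.
  rewrite lt_neqAle tr andbT; apply/eqP => e.
  move: e; case: ger0P => h e; first by move/eqP: tn2; lra.
  by move/eqP: tn1; lra.
have tr2 : `|t - m| < 2 * pi - r by rewrite ltr_norml; lra.
by have := @cos_dist_lt (t - m) r rp; rewrite tr' tr2 => /(_ isT); lra.
Qed.

(** The steep trigonometric polynomials annihilate [g] and converge boundedly to the
    indicator of the ball. *)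
Lemma fourier_null_ball (g : R -> R[i]) (m r : R) : fourier_null g ->
  0 < r < pi -> 0 < m - r -> m + r < 2 * pi ->
  cintegral arc (fun t => (\1_(ball m r) t)%:C * g t) = 0.
Proof.
move=> hg rp mr1 mr2; have [gL _] := hg; have [i1 i2] := Lfun2C_integrable gL.
have mg := Lfun2C_measurable gL.
have mulRe (a : R) (z : R[i]) : Re (a%:C * z) = a * Re z by case: z => x y /=; ring.
have mulIm (a : R) (z : R[i]) : Im (a%:C * z) = a * Im z by case: z => x y /=; ring.
apply: (@cintegral_dominated0 _ _ _ arc (fun n t => (steep_arc m (cos r) n t)%:C * g t) _
  (fun t => `|Re (g t)| + `|Im (g t)|)).
- by move=> n; have [/Lfun2C_integrable] := null_mult_steep m (cos r) n hg.
- apply: cmeasurableM => //; split; last exact: measurable_cst.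
  by apply: measurable_indic; exact: measurable_ball.
- have := integrable_lin 1 (integrable_norm i1) (integrable_norm i2).
  by under eq_fun do rewrite mul1r.
- apply: filterS3 arc_ae_itv (arc_ae_neq (m - r)) (arc_ae_neq (m + r)) => t t1 t2 t3.
  rewrite mulRe mulIm; have c := steep_arc_cvg rp mr1 mr2 t1 t2 t3.
  split.
  + by under eq_fun do rewrite mulRe; apply: cvgM; [exact: c|exact: cvg_cst].
  + by under eq_fun do rewrite mulIm; apply: cvgM; [exact: c|exact: cvg_cst].
- apply: aeW => t n; rewrite mulRe mulIm !normrM.
  have /andP[s0 s1] := steep_arc_itv m r t n; rewrite (ger0_norm s0).
  have h (a : R) : steep_arc m (cos r) n t * `|a| <= `|a| by exact: ler_piMl.
  by split; apply: (le_trans (h _)); [rewrite lerDl|rewrite lerDr].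
- move=> n; have [_ /(_ 0%N)[<- _]] := null_mult_steep m (cos r) n hg.
  by congr cintegral; apply/funext => t; rewrite expr0 mulr1.
Qed.

(** Lebesgue differentiation: almost every value of [h] is a limit of averages over
    balls. *)
Lemma ball_integrals_ae0 (h : R -> R) : arc.-integrable setT (EFin \o h) ->
  (forall m r : R, 0 < r < pi -> 0 < m - r -> m + r < 2 * pi ->
    \int[arc]_(t in setT) (\1_(ball m r) t * h t) = 0) ->
  {ae arc, forall t, h t = 0}.
Proof.
move=> ih hball.
have [il _] := arc_Rintegral ih.
pose G := h \_ [set` `[0, 2 * pi]%R].
have iG : leb.-integrable setT (EFin \o G).
  have -> : EFin \o G = (EFin \o h) \_ [set` `[0, 2 * pi]%R] by rewrite restrict_EFin.
  by apply: (iffLR (integrable_mkcond _ _)) => //; exact: il.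
pose E (x : R) (n : nat) : set R := ball x n.+1%:R^-1.
have nE x : nicely_shrinking x (E x).
  split; first by move=> n; exact: measurable_ball.
  exists (1, fun n => PosNum (ltac:(by rewrite invr_gt0) : 0 < n.+1%:R^-1 :> R)); split.
  - exact: ltr01.
  - exact: cvg_harmonic.
  - by move=> n.
  - by move=> n; rewrite -[leLHS]mul1e.
have lG : locally_integrable setT G.
  by apply: open_integrable_locally => //; exact: openT.
have aeG := lebesgue_differentiation lG.
have ball0 (x r : R) : 0 < r < pi -> 0 < x - r -> x + r < 2 * pi ->
    (\int[leb]_(y in ball x r) (G y)%:E = 0)%E.
  move=> rp xr1 xr2; have := hball x r rp xr1 xr2.
  have ib : arc.-integrable setT (EFin \o (fun t => \1_(ball x r) t * h t)).
    have /measurable_int/measurable_EFinP mh := ih.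
    apply: (le_integrable measurableT _ _ ih) => //.
      apply/measurable_EFinP; apply: measurable_funM => //.
      by apply: measurable_indic; exact: measurable_ball.
    move=> t _; rewrite /= lee_fin normrM indicE.
    by case: (_ \in _); rewrite ?normr1 ?normr0 ?mul1r ?mul0r.
  rewrite (arc_Rintegral ib).2 => /eqP; rewrite mulf_eq0 invr_eq0 gt_eqF ?twopi_gt0//= => /eqP e.
  rewrite -[LHS]fineK; last first.
    apply: integrable_fin_num; first exact: measurable_ball.
    by apply: (integrableS measurableT _ _ iG) => //; exact: measurable_ball.
  congr (_%:E); rewrite -[RHS]e -[LHS]/(Rintegral _ _ _) Rintegral_mkcond [RHS]Rintegral_mkcond.
  apply: eq_Rintegral => t _; rewrite /G !patchE.
  by rewrite indicE; case: (t \in (ball x r : set R)); case: (t \in _); rewrite ?mul1r ?mul0r.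
have zero (x : R) : 0 < x < 2 * pi -> lebesgue_pt G x -> G x = 0.
  move=> /andP[x0 x2] px.
  have c := nice_lebesgue_differentiation nE lG px.
  have d0 : 0 < Num.min (Num.min x (2 * pi - x)) pi.
    by rewrite !lt_min x0 pi_gt0 subr_gt0 x2.
  suff c0 : ((leb (E x n))^-1 * \int[leb]_(y in E x n) (G y)%:E)%E @[n --> \oo] --> (0 : \bar R)%E.
    by apply: EFin_inj; exact: (cvg_unique (@ereal_hausdorff R) c c0).
  apply: cvg_near_cst; apply: filterS (near_infty_natSinv_lt (PosNum d0)) => n /=.
  rewrite !lt_min => /andP[/andP[n1 n2] n3].
  by rewrite /E ball0 ?mule0//; [rewrite n3 invr_gt0 ltr0n|rewrite subr_gt0|rewrite addrC -ltrBrDr].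
have ae4 : {ae arc, forall t, t != 2 * pi /\ lebesgue_pt G t}.
  by apply: filterS2 (arc_ae_neq (2 * pi)) (arc_ae_lebesgue aeG) => t.
apply: filterS3 arc_ae_itv (arc_ae_neq 0) ae4 => t /andP[t0 t2] tn0 [tn2 /zero Gt].
have : G t = 0 by apply: Gt; rewrite !lt_neqAle t0 t2 eq_sym tn0 tn2.
by rewrite /G patchE ifT// inE/= in_itv/= t0.
Qed.

Lemma fourier_unique (x : L2 R) :
  (forall n, cintegral arc (fun t => L2C_fun x t * cis t ^+ n) = 0) ->
  (forall n, cintegral arc (fun t => L2C_fun x t * (cis t ^+ n)^*%C) = 0) -> x = 0.
Proof.
move=> h1 h2; have hg : fourier_null (L2C_fun x) by split; [exact: L2C_fun_in|].
have [i1 i2] := Lfun2C_integrable (L2C_fun_in x).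
have aeRe : {ae arc, forall t, Re (L2C_fun x t) = 0}.
  apply: (ball_integrals_ae0 i1) => m r r1 r2 r3.
  transitivity (Re (cintegral arc (fun t => (\1_(ball m r) t)%:C * L2C_fun x t))).
    by apply: eq_Rintegral => t _ /=; case: (L2C_fun x t) => a b /=; ring.
  by rewrite fourier_null_ball.
have aeIm : {ae arc, forall t, Im (L2C_fun x t) = 0}.
  apply: (ball_integrals_ae0 i2) => m r r1 r2 r3.
  transitivity (Im (cintegral arc (fun t => (\1_(ball m r) t)%:C * L2C_fun x t))).
    by apply: eq_Rintegral => t _ /=; case: (L2C_fun x t) => a b /=; ring.
  by rewrite fourier_null_ball.
apply: L2C_inj; apply: filterS3 aeRe aeIm (L2C_fun0 arc) => t.
by case: (L2C_fun x t) => a b /= -> -> ->.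
Qed.

End FourierUniqueness.

(** * The Hardy space and its shift *)

Section Hardy.
Context (R : realType).
Local Notation Re := (@complex.Re R).
Local Notation Im := (@complex.Im R).
Local Notation arc := (@Defs.arc R).
Local Notation L2s := (L2C_space arc).
Local Notation H2 := (H2 R).
Local Notation mop := (@mulop _ _ R arc).
Implicit Types (x y : L2 R) (phi : R -> R[i]).

Definition cis_class n : L2 R := L2C_class arc (fun t => cis t ^+ n).

Lemma cisX_in n : (fun t : R => cis t ^+ n) \in Lfun2C arc.
Proof.
have := Lfun2C_cisX n (Lfun2C_cst (1 : R[i])).
by under eq_fun do rewrite mul1r.
Qed.

Lemma cis_class_fun n : {ae arc, forall t, L2C_fun (cis_class n) t = cis t ^+ n}.
Proof. exact: L2C_fun_class (cisX_in n). Qed.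

Lemma L2C_ip_class x f : f \in Lfun2C arc ->
  L2C_ip x (L2C_class arc f) = cintegral arc (fun t => L2C_fun x t * (f t)^*%C).
Proof.
move=> hf; apply: (L2C_ip_ae (L2C_fun_measurable x) (Lfun2C_measurable hf)); first exact: aeW.
exact: L2C_fun_class.
Qed.

(** The Fourier coefficients are inner products with the conjugates of powers of
    [cis]. *)
Lemma H2_closed : closed_subspace L2s (carrier H2).
Proof.
pose N := [set z : L2 R | exists2 n : nat, (0 < n)%N &
  z = L2C_class arc (fun t => (cis t ^+ n)^*%C)].
have -> : carrier H2 = [set x | carrier L2s x /\ forall z, N z -> ip L2s x z = 0].
  have e x n : ip L2s x (L2C_class arc (fun t => (cis t ^+ n)^*%C)) =
      cintegral arc (fun t => L2C_fun x t * cis t ^+ n).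
    rewrite /= L2C_ip_class; last exact/Lfun2C_conj/cisX_in.
    by congr cintegral; apply/funext => t; rewrite conjcK.
  apply/seteqP; split => x.
    by move=> hx; split=> // z [n n0 ->]; rewrite e; exact: hx.
  by move=> [_ hx] n n0; rewrite -e; apply: hx; exists n.
exact: (orth_closed (L2C_hilbert arc)).
Qed.

Lemma H2_hilbert : hilbert H2.
Proof. exact: (hilbert_sub (L2C_hilbert arc) H2_closed). Qed.

Lemma toeplitz_car phi x : carrier H2 (toeplitz phi x).
Proof. by have [] := orth_proj_spec (L2C_hilbert arc) H2_closed (x := mop phi x) I. Qed.

Lemma toeplitz_ip phi x y : carrier H2 y ->
  ip H2 (toeplitz phi x) y = L2C_ip (mop phi x) y.
Proof.
move=> hy; have [_ h] := orth_proj_spec (L2C_hilbert arc) H2_closed (x := mop phi x) I.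
have := h _ hy; rewrite (ipBl (L2C_hilbert arc))// => /eqP; rewrite subr_eq0 => /eqP e.
exact: esym e.
Qed.

(** On [H^2] the projection can be dropped from either side of the inner product. *)
Lemma toeplitz_adj phi x y : contractive_symbol arc phi -> carrier H2 x -> carrier H2 y ->
  ip H2 (toeplitz phi x) y = ip H2 x (toeplitz (fun t => (phi t)^*%C) y).
Proof.
move=> hp hx hy; rewrite toeplitz_ip// mulop_adj//.
rewrite (ipC H2_hilbert (toeplitz_car _ _) hx) toeplitz_ip//.
by rewrite -(ipC (L2C_hilbert arc)).
Qed.

(** These are the functions in the unit ball of [H^oo] of the circle, described by
    their action: a multiplier of [H^2] is its own Toeplitz operator. *)
Definition analytic_symbol phi : Prop :=
  contractive_symbol arc phi /\ forall x, carrier H2 x -> carrier H2 (mop phi x).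

Lemma toeplitz_analytic phi x : analytic_symbol phi -> carrier H2 x ->
  toeplitz phi x = mop phi x.
Proof. by move=> [_ hp] hx; apply: (orth_proj_id (L2C_hilbert arc) H2_closed); exact: hp. Qed.

Lemma cintegral_mulop phi x (f : R -> R[i]) : contractive_symbol arc phi -> cmeasurable f ->
  cintegral arc (fun t => L2C_fun (mop phi x) t * f t) =
  cintegral arc (fun t => phi t * L2C_fun x t * f t).
Proof.
move=> hp mf; have [mp _] := hp; apply: cintegral_ae.
- by apply: cmeasurableM => //; exact: L2C_fun_measurable.
- by apply: cmeasurableM => //; apply: cmeasurableM => //; exact: L2C_fun_measurable.
- by apply: filterS (mulop_fun x hp) => t ->.
Qed.

Lemma analytic_cis : analytic_symbol (@cis R).
Proof.
split; first exact: bounded_cis.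
move=> x hx n n0; rewrite cintegral_mulop; [|exact: bounded_cis|exact: cmeasurable_cisX].
rewrite -(hx n.+1 isT); congr cintegral; apply/funext => t.
by rewrite exprS; ring.
Qed.

(** This covers the default value of [boundary]. *)
Lemma analytic0 : analytic_symbol (fun=> 0).
Proof.
have ub : contractive_symbol arc (fun=> 0).
  by split; [exact: cmeasurable_cst|apply: aeW => t; rewrite /= expr0n addr0].
split=> // x hx n n0; rewrite cintegral_mulop; [|exact: ub|exact: cmeasurable_cisX].
by rewrite -[RHS](cintegral0 arc); congr cintegral; apply/funext => t; rewrite !mul0r.
Qed.

Local Notation S := (toeplitz (@cis R)).
Local Notation Ss := (@backward_shift R).
Local Notation one := (cis_class 0).

Lemma S_mulop x : carrier H2 x -> S x = mop (@cis R) x.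
Proof. by move=> hx; apply: toeplitz_analytic => //; exact: analytic_cis. Qed.

Lemma backward_shift_shift x : carrier H2 x -> Ss (S x) = x.
Proof.
move=> hx; apply: (ip_inj H2_hilbert) => //; first exact: toeplitz_car.
move=> z hz; rewrite toeplitz_ip// S_mulop// /=.
rewrite mulop_adj; last exact: contractive_symbol_conj (bounded_cis R).
have -> : (fun t => ((cis t)^*%C)^*%C) = @cis R by apply/funext => t; rewrite conjcK.
rewrite mulop_adj; last exact: bounded_cis.
congr L2C_ip; apply: L2C_inj.
have h := mulop_comp_fun z (contractive_symbol_conj (bounded_cis R)) (bounded_cis R).
by apply: filterS h => t ->; rewrite mulrA cisJ mul1r.
Qed.

Lemma cis_class_H2 n : carrier H2 (cis_class n).
Proof.
move=> k k0; rewrite -[RHS](@cintegral_cisX R (n + k)); last by rewrite addn_gt0 k0 orbT.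
apply: cintegral_ae.
- by apply: cmeasurableM; [exact: L2C_fun_measurable|exact: cmeasurable_cisX].
- exact: cmeasurable_cisX.
- by apply: filterS (cis_class_fun n) => t ->; rewrite exprD.
Qed.

Lemma iter_shift n : iter n S one = cis_class n.
Proof.
elim: n => // n IH; rewrite iterS IH S_mulop; last exact: cis_class_H2.
apply: L2C_inj; have h := mulop_fun (cis_class n) (bounded_cis R).
by apply: filterS3 h (cis_class_fun n) (cis_class_fun n.+1) => t -> -> ->; rewrite exprS.
Qed.

Lemma ip_one x : ip H2 x one = cintegral arc (L2C_fun x).
Proof.
rewrite /= L2C_ip_class; last exact: cisX_in.
by congr cintegral; apply/funext => t; rewrite expr0 rmorph1 mulr1.
Qed.

Lemma one_norm : ip H2 one one = 1.
Proof.
rewrite ip_one (@cintegral_ae _ _ _ _ _ (fun=> 1)).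
- by rewrite /cintegral /= arc_integral1 /Rintegral integral0.
- exact: L2C_fun_measurable.
- exact: cmeasurable_cst.
- by apply: filterS (cis_class_fun 0) => t ->; rewrite expr0.
Qed.

(** The coefficients of nonnegative index vanish by hypothesis, those of negative
    index because [x] is in [H^2]. *)
Lemma shift_total x : carrier H2 x -> (forall n, ip H2 x (iter n S one) = 0) -> x = 0.
Proof.
move=> hx h; have hc n : cintegral arc (fun t => L2C_fun x t * (cis t ^+ n)^*%C) = 0.
  by rewrite -(h n) iter_shift /= L2C_ip_class//; exact: cisX_in.
apply: fourier_unique => //; case=> [|n]; last exact: hx.
by rewrite -[RHS](hc 0%N); congr cintegral; apply/funext => t; rewrite expr0 rmorph1.
Qed.

(** [x] minus its constant term is [cis] times an element [y] of [H^2], and [y] is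
    the backward shift of [x]. *)
Lemma wold_decomposition x : carrier H2 x -> x = S (Ss x) + ip H2 x one *: one.
Proof.
move=> hx; set c := ip H2 x one.
have hone := cis_class_H2 0.
have bc := bounded_cis R; have bcc := contractive_symbol_conj bc.
have hxc : carrier H2 (x - c *: one).
  by apply: (carB H2_hilbert) => //; exact: (carZ H2_hilbert).
pose y := mop (fun t => (cis t)^*%C) (x - c *: one).
have xc_fun : {ae arc, forall t, L2C_fun (x - c *: one) t = L2C_fun x t - c}.
  have h1 := L2C_funZD (- c) one x; rewrite scaleNr addrC in h1.
  by apply: filterS2 h1 (cis_class_fun 0) => t -> ->; rewrite expr0 mulr1 addrC.
have hy : carrier H2 y.
  move=> [//|n] _; rewrite cintegral_mulop//; last exact: cmeasurable_cisX.
  transitivity (cintegral arc (fun t => L2C_fun (x - c *: one) t * cis t ^+ n)).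
    by congr cintegral; apply/funext => t; rewrite exprS -[RHS]mul1r -(cisJ t); ring.
  case: n => [|n]; last exact: hxc.
  transitivity (ip H2 (x - c *: one) one).
    by rewrite ip_one; congr cintegral; apply/funext => t; rewrite expr0 mulr1.
  rewrite (ipBl H2_hilbert)//; last exact: (carZ H2_hilbert).
  by rewrite (ipZl H2_hilbert)// one_norm mulr1 subrr.
have Sy : S y = x - c *: one.
  rewrite S_mulop//; apply: L2C_inj.
  have h := mulop_comp_fun (x - c *: one) bc bcc.
  by apply: filterS h => t ->; rewrite mulrA [cis t * _]mulrC cisJ mul1r.
have Ss1 : Ss one = 0.
  apply: (ip_eq0 H2_hilbert); first exact: toeplitz_car.
  move=> z hz; rewrite toeplitz_ip// mulop_adj//.
  have -> : (fun t => ((cis t)^*%C)^*%C) = @cis R by apply/funext => t; rewrite conjcK.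
  have e : L2C_ip (mop (@cis R) z) one = 0.
    rewrite -[LHS]/(ip H2 _ one) ip_one -(hz 1%N isT); apply: cintegral_ae.
    - exact: L2C_fun_measurable.
    - by apply: cmeasurableM; [exact: L2C_fun_measurable|exact: cmeasurable_cisX].
    - by apply: filterS (mulop_fun z bc) => t ->; rewrite expr1 mulrC.
  transitivity ((L2C_ip (mop (@cis R) z) one)^*%C); last by rewrite e rmorph0.
  exact: (@ipC _ _ _ (L2C_hilbert arc) (mop (@cis R) z) one I I).
suff -> : Ss x = y by rewrite Sy addrNK.
have lin : linear_on (carrier H2) Ss.
  apply: (adjoint_pair_linear H2_hilbert (Ts := S)) => [z _|z _|z w hz hw].
  - exact: toeplitz_car.
  - exact: toeplitz_car.
  - have e := toeplitz_adj bcc hz hw.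
    have cc : (fun t => ((cis t)^*%C)^*%C) = @cis R by apply/funext => t; rewrite conjcK.
    by rewrite cc in e; exact: e.
have {1}-> : x = c *: one + S y by rewrite Sy addrC addrNK.
rewrite lin//; last exact: toeplitz_car.
by rewrite Ss1 scaler0 add0r backward_shift_shift.
Qed.

Lemma toeplitz_analytic_shift phi x : analytic_symbol phi -> carrier H2 x ->
  toeplitz phi (S x) = S (toeplitz phi x).
Proof.
move=> hp hx; have hSx : carrier H2 (S x) by exact: toeplitz_car.
have hpx : carrier H2 (toeplitz phi x) by exact: toeplitz_car.
rewrite (toeplitz_analytic hp hSx) (S_mulop hpx) (toeplitz_analytic hp hx) S_mulop//.
by apply: mulopC; [case: hp|exact: bounded_cis].
Qed.

End Hardy.

(** * Boundary functions of bounded analytic functions *)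

Section ComplexLimits.
Context (R : realType).
Local Notation Re := (@complex.Re R).
Local Notation Im := (@complex.Im R).
Implicit Types z w : R[i].

Definition cabs z : R := Num.sqrt (Re z ^+ 2 + Im z ^+ 2).

Lemma cabsE z : `|z| = (cabs z)%:C. Proof. by case: z. Qed.
Lemma cabs_ge0 z : 0 <= cabs z. Proof. exact: sqrtr_ge0. Qed.
Lemma cabsM z w : cabs (z * w) = cabs z * cabs w.
Proof. by apply: (@complexI R); rewrite rmorphM/= -!cabsE normrM. Qed.
Lemma cabsD z w : cabs (z + w) <= cabs z + cabs w.
Proof. by rewrite -lecR rmorphD/= -!cabsE ler_normD. Qed.
Lemma cabs_real (r : R) : 0 <= r -> cabs r%:C = r.
Proof. by move=> r0; rewrite /cabs /= expr0n addr0 sqrtr_sqr ger0_norm. Qed.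
Lemma cabsX z n : cabs (z ^+ n) = cabs z ^+ n.
Proof. by apply: (@complexI R); rewrite rmorphXn/= -!cabsE normrX. Qed.
Lemma cabs_sum (I : Type) (s : seq I) (F : I -> R[i]) :
  cabs (\sum_(i <- s) F i) <= \sum_(i <- s) cabs (F i).
Proof.
elim: s => [|i s IH]; first by rewrite !big_nil /cabs/= expr0n addr0 sqrtr0.
by rewrite !big_cons; apply: le_trans (cabsD _ _) _; rewrite lerD2l.
Qed.
Lemma cabs_cis (t : R) : cabs (cis t) = 1.
Proof. by rewrite /cabs cisE sqrtr1. Qed.
Lemma Re_le_cabs z : `|Re z| <= cabs z.
Proof. by rewrite -sqrtr_sqr ler_wsqrtr// lerDl sqr_ge0. Qed.
Lemma Im_le_cabs z : `|Im z| <= cabs z.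
Proof. by rewrite -sqrtr_sqr ler_wsqrtr// lerDr sqr_ge0. Qed.
Lemma cabs_le_ReIm z : cabs z <= `|Re z| + `|Im z|.
Proof.
rewrite -[leRHS]ger0_norm ?addr_ge0// -sqrtr_sqr ler_wsqrtr//.
rewrite -(real_normK (num_real (Re z))) -(real_normK (num_real (Im z))).
have := normr_ge0 (Re z); have := normr_ge0 (Im z); nra.
Qed.

(** Convergence in the complex plane, read with real radii. *)
Lemma ccvg_cabs (T : Type) (F : set_system T) (f : T -> R[i]) (l : R[i]) : Filter F ->
  f x @[x --> F] --> (l : R[i]^o) -> forall e : R, 0 < e -> \forall x \near F, cabs (l - f x) < e.
Proof.
move=> FF h e e0; have := (@cvgrPdist_lt R[i] (R[i]^o) T F FF f l).1 h e%:C.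
rewrite ltcR => /(_ e0).
by apply: filterS => x; rewrite cabsE ltcR.
Qed.

Lemma ccvg_Re (T : Type) (F : set_system T) (f : T -> R[i]) (l : R[i]) : Filter F ->
  f x @[x --> F] --> (l : R[i]^o) -> Re (f x) @[x --> F] --> Re l.
Proof.
move=> FF h; apply/cvgrPdist_lt => e e0; apply: filterS (ccvg_cabs FF h e0) => x.
by apply: le_lt_trans; rewrite -raddfB; exact: Re_le_cabs.
Qed.

Lemma ccvg_Im (T : Type) (F : set_system T) (f : T -> R[i]) (l : R[i]) : Filter F ->
  f x @[x --> F] --> (l : R[i]^o) -> Im (f x) @[x --> F] --> Im l.
Proof.
move=> FF h; apply/cvgrPdist_lt => e e0; apply: filterS (ccvg_cabs FF h e0) => x.
by apply: le_lt_trans; rewrite -raddfB; exact: Im_le_cabs.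
Qed.

(** The terms are bounded at the larger radius, so on the smaller circle the series
    is dominated by a geometric one, uniformly in the angle and in the number of
    terms. *)
Lemma power_series_bounded (a : nat -> R[i]) (l : R[i]) (rho r : R) : 0 <= r < rho ->
  \sum_(k < n) a k * rho%:C ^+ k @[n --> \oo] --> (l : R[i]^o) ->
  exists K : R, forall n t, cabs (\sum_(k < n) a k * (r%:C * cis t) ^+ k) <= K.
Proof.
move=> /andP[r0 rrho] cv; have rho0 : 0 < rho by exact: le_lt_trans r0 rrho.
have [N _ hN] := ccvg_cabs _ cv (ltr01 : 0 < (1 : R)).
pose C := 2 + \sum_(k < N) cabs (a k * rho%:C ^+ k).
have C0 : 0 <= C by rewrite addr_ge0// sumr_ge0// => k _; exact: cabs_ge0.
have term k : cabs (a k) * rho ^+ k <= C.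
  have -> : cabs (a k) * rho ^+ k = cabs (a k * rho%:C ^+ k).
    by rewrite cabsM cabsX cabs_real// ltW.
  have [kN|Nk] := ltnP k N.
    rewrite /C (bigD1 (Ordinal kN))//= addrCA lerDl addr_ge0// sumr_ge0// => i _.
    exact: cabs_ge0.
  (* A term of index at least [N] is a difference of two remainders of size less than 1. *)
  have h1 := hN k Nk; have h2 := hN k.+1 (leqW Nk); rewrite /= in h1 h2.
  have -> : a k * rho%:C ^+ k = (l - \sum_(k < k) a k * rho%:C ^+ k) +
       (-1) * (l - \sum_(k < k.+1) a k * rho%:C ^+ k).
    by rewrite big_ord_recr/=; ring.
  apply: le_trans (cabsD _ _) _; rewrite cabsM.
  have -> : cabs (-1) = 1 by rewrite /cabs/= oppr0 expr0n addr0 sqrrN expr1n sqrtr1.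
  rewrite mul1r; apply: (@le_trans _ _ 2); first by apply: ltW; lra.
  by rewrite lerDl sumr_ge0// => i _; exact: cabs_ge0.
pose q := r / rho.
have q0 : 0 <= q by rewrite divr_ge0// ltW.
have q1 : q < 1 by rewrite ltr_pdivrMr// mul1r.
exists (C / (1 - q)) => n t; apply: le_trans (cabs_sum _ _) _.
apply: (@le_trans _ _ (\sum_(k < n) C * q ^+ k)).
  apply: ler_sum => k _; rewrite cabsM cabsX cabsM cabs_cis mulr1 cabs_real//.
  have -> : r ^+ k = rho ^+ k * q ^+ k by rewrite -exprMn mulrC divfK// gt_eqF.
  by rewrite mulrA ler_wpM2r// exprn_ge0.
rewrite -mulr_sumr ler_wpM2l// -[leRHS]mul1r ler_pdivlMr ?subr_gt0//.
have -> : (\sum_(k < n) q ^+ k) * (1 - q) = 1 - q ^+ n.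
  by have := subrX1 q n; rewrite mulrC => e; rewrite -[RHS]opprB e; ring.
by rewrite lerBlDr lerDl exprn_ge0.
Qed.

End ComplexLimits.

Section Boundary.
Context (R : realType).
Local Notation Re := (@complex.Re R).
Local Notation Im := (@complex.Im R).
Local Notation arc := (@Defs.arc R).
Local Notation H2 := (H2 R).
Variable b : R[i] -> R[i].
Hypothesis hb : Hinf_ball b.

Lemma circle_lt1 (r t : R) : 0 <= r < 1 -> `|r%:C * cis t| < 1.
Proof.
move=> /andP[r0 r1]; rewrite cabsE cabsM cabs_cis mulr1 cabs_real//.
by rewrite -[X in _ < X](rmorph1 (real_complex R)) ltcR.
Qed.

Lemma circle_cabs_le1 (r t : R) : 0 <= r < 1 -> cabs (b (r%:C * cis t)) <= 1.
Proof.
move=> hr; have [_ /(_ _ (circle_lt1 t hr))] := hb.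
by rewrite cabsE -[X in _ <= X](rmorph1 (real_complex R)) lecR.
Qed.

(** Analyticity is used at the centre on the whole unit disk, so that one series
    serves all radii. *)
Lemma taylor_circle : exists a : nat -> R[i], forall r : R, 0 <= r < 1 ->
  (forall t, \sum_(k < n) a k * (r%:C * cis t) ^+ k @[n --> \oo] --> (b (r%:C * cis t) : R[i]^o)) /\
  exists K : R, forall n t, cabs (\sum_(k < n) a k * (r%:C * cis t) ^+ k) <= K.
Proof.
have [an _] := hb; have [|a ha] := an 0 1 ltr01; first by move=> z; rewrite subr0 rmorph1.
have ha' z : `|z| < 1 -> \sum_(k < n) a k * z ^+ k @[n --> \oo] --> (b z : R[i]^o).
  by move=> z1; have := ha z; rewrite subr0; apply; rewrite rmorph1.
exists a => r /andP[r0 r1]; split.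
  by move=> t; apply: ha'; apply: circle_lt1; rewrite r0.
(* The series converges at [(1 + r) / 2], between [r] and 1. *)
apply: (@power_series_bounded _ a (b ((1 + r) / 2)%:C) ((1 + r) / 2)); first by rewrite r0/=; lra.
apply: ha'; rewrite cabsE cabs_real; last by lra.
by rewrite -[X in _ < X](rmorph1 (real_complex R)) ltcR; lra.
Qed.

Lemma cmeasurable_circle (r : R) : 0 <= r < 1 -> cmeasurable (fun t => b (r%:C * cis t)).
Proof.
move=> hr; have [a /(_ r hr)[cv _]] := taylor_circle.
have mP n : cmeasurable (fun t => \sum_(k < n) a k * (r%:C * cis t) ^+ k).
  elim: n => [|n IH].
    by under eq_fun do rewrite big_ord0; exact: cmeasurable_cst.
  under eq_fun do rewrite big_ord_recr/=; apply: cmeasurableD => //.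
  under eq_fun do rewrite exprMn mulrA; apply: cmeasurableM; last exact: cmeasurable_cisX.
  exact: cmeasurable_cst.
split.
- apply: (@measurable_fun_cvg _ _ _ _ (fun n t => Re (\sum_(k < n) a k * (r%:C * cis t) ^+ k))).
    by move=> n; case: (mP n).
  by move=> t _; apply: ccvg_Re; exact: cv.
- apply: (@measurable_fun_cvg _ _ _ _ (fun n t => Im (\sum_(k < n) a k * (r%:C * cis t) ^+ k))).
    by move=> n; case: (mP n).
  by move=> t _; apply: ccvg_Im; exact: cv.
Qed.

Lemma bounded_circle (r : R) : 0 <= r < 1 -> contractive_symbol arc (fun t => b (r%:C * cis t)).
Proof.
move=> hr; split; first exact: cmeasurable_circle.
apply: aeW => t; have := circle_cabs_le1 t hr.
by rewrite /cabs -{1}sqrtr1 ler_sqrt.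
Qed.

Lemma ReM_le (z w : R[i]) (K : R) : cabs z <= K -> `|Re (z * w)| <= K * (`|Re w| + `|Im w|).
Proof.
move=> zK; apply: le_trans (Re_le_cabs _) _; rewrite cabsM.
by apply: ler_pM; rewrite ?cabs_ge0 ?cabs_le_ReIm.
Qed.

Lemma ImM_le (z w : R[i]) (K : R) : cabs z <= K -> `|Im (z * w)| <= K * (`|Re w| + `|Im w|).
Proof.
move=> zK; apply: le_trans (Im_le_cabs _) _; rewrite cabsM.
by apply: ler_pM; rewrite ?cabs_ge0 ?cabs_le_ReIm.
Qed.

Lemma mulr_ccvg (u : nat -> R[i]) (l w : R[i]) :
  Re (u n) @[n --> \oo] --> Re l -> Im (u n) @[n --> \oo] --> Im l ->
  Re (u n * w) @[n --> \oo] --> Re (l * w) /\ Im (u n * w) @[n --> \oo] --> Im (l * w).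
Proof.
have ReM (z z' : R[i]) : Re (z * z') = Re z * Re z' - Im z * Im z' by case: z z' => [p q] [p' q'].
have ImM (z z' : R[i]) : Im (z * z') = Re z * Im z' + Im z * Re z' by case: z z' => [p q] [p' q'].
move=> c1 c2; split.
- rewrite ReM; under eq_fun do rewrite ReM.
  by apply: cvgB; apply: cvgM => //; exact: cvg_cst.
- rewrite ImM; under eq_fun do rewrite ImM.
  by apply: cvgD; apply: cvgM => //; exact: cvg_cst.
Qed.

Lemma integrable_ReIm (f : R -> R[i]) (K : R) : cintegrable arc f ->
  arc.-integrable setT (EFin \o (fun t => K * (`|Re (f t)| + `|Im (f t)|))).
Proof.
move=> [i1 i2].
have h := integrable_lin 1 (integrable_norm i1) (integrable_norm i2).
have := integrable_lin K h (integrable0 arc setT).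
by under eq_fun do rewrite addr0 mul1r.
Qed.

(** Each Taylor polynomial times [x cis^n] is a combination of the [x cis^(n + k)],
    whose integrals vanish as [x] is in [H^2]. *)
Lemma cintegral_circle (r : R) (x : L2 R) n : 0 <= r < 1 -> carrier H2 x -> (0 < n)%N ->
  cintegral arc (fun t => b (r%:C * cis t) * (L2C_fun x t * cis t ^+ n)) = 0.
Proof.
move=> hr hx n0; have [a /(_ r hr)[cv [K hK]]] := taylor_circle.
have iG m : cintegrable arc (fun t => L2C_fun x t * cis t ^+ m).
  by apply: Lfun2C_integrable; apply: Lfun2C_cisX; exact: L2C_fun_in.
pose P m t := (\sum_(k < m) a k * (r%:C * cis t) ^+ k) * (L2C_fun x t * cis t ^+ n).
have step m : cintegrable arc (P m) /\ cintegral arc (P m) = 0.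
  rewrite /P.
  elim: m => [|m [IH1 IH2]].
    under eq_fun do rewrite big_ord0 mul0r.
    by split; [exact: cintegrable0|exact: cintegral0].
  have e : (fun t => (\sum_(k < m.+1) a k * (r%:C * cis t) ^+ k) * (L2C_fun x t * cis t ^+ n)) =
    fun t => (a m * r%:C ^+ m) * (L2C_fun x t * cis t ^+ (n + m)) +
      (\sum_(k < m) a k * (r%:C * cis t) ^+ k) * (L2C_fun x t * cis t ^+ n).
    by apply/funext => t; rewrite big_ord_recr/= exprMn exprD; ring.
  rewrite e; split; first by apply: cintegrableZD => //; exact: iG.
  by rewrite cintegralZD// IH2 addr0 hx ?mulr0// addn_gt0 n0.
apply: (cintegral_dominated0 (fun m => (step m).1) _ (integrable_ReIm K (iG n))).
- apply: cmeasurableM; first exact: cmeasurable_circle.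
  exact: cintegrable_measurable.
- by apply: aeW => t; apply: mulr_ccvg; [exact: ccvg_Re (cv t)|exact: ccvg_Im (cv t)].
- by apply: aeW => t m; split; [apply: ReM_le|apply: ImM_le].
- by move=> m; case: (step m).
Qed.

(** The integrals that define [H^2] vanish for the circles of radius [r] and converge
    as [r] tends to 1 through [1 - 1 / (n + 2)]. *)
Lemma radial_symbol phi : cmeasurable phi ->
  {ae arc, forall t : R, b (r%:C * cis t) @[r --> (1 : R)^'-] --> (phi t : R[i]^o)} ->
  analytic_symbol phi.
Proof.
move=> mphi radial.
pose r n : R := 1 - n.+2%:R^-1.
have r01 n : 0 <= r n < 1.
  rewrite /r subr_ge0 invf_le1// ler1n/= ltrBlDr ltrDl invr_gt0.
  by rewrite ltr0n.
have r1 : r n @[n --> \oo] --> (1 : R)^'-.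
  have r1 : r n @[n --> \oo] --> (1 : R).
    rewrite -[X in _ --> X]subr0; apply: cvgB; first exact: cvg_cst.
    by have := @cvg_harmonic R; rewrite -(cvg_shiftS (@harmonic R)).
  move=> A hA; have [N hN hr] := r1 _ hA; exists N => // n Nn.
  by apply: (hr n Nn); case/andP: (r01 n).
have lim : {ae arc, forall t, Re (b ((r n)%:C * cis t)) @[n --> \oo] --> Re (phi t) /\
    Im (b ((r n)%:C * cis t)) @[n --> \oo] --> Im (phi t)}.
  apply: filterS radial => t h; have c := cvg_comp _ _ r1 h.
  by split; [exact: ccvg_Re c|exact: ccvg_Im c].
have ub : contractive_symbol arc phi.
  split=> //; apply: filterS lim => t [c1 c2].
  have c : Re (b ((r n)%:C * cis t)) ^+ 2 + Im (b ((r n)%:C * cis t)) ^+ 2 @[n --> \oo] -->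
     Re (phi t) ^+ 2 + Im (phi t) ^+ 2 by apply: cvgD; apply: cvgM.
  apply: (cvgr_to_le c); apply: nearW => n.
  by have := circle_cabs_le1 t (r01 n); rewrite /cabs -{1}sqrtr1 ler_sqrt.
split=> // x hx n n0; rewrite cintegral_mulop//; last exact: cmeasurable_cisX.
have iG : cintegrable arc (fun t => L2C_fun x t * cis t ^+ n).
  by apply: Lfun2C_integrable; apply: Lfun2C_cisX; exact: L2C_fun_in.
transitivity (cintegral arc (fun t => phi t * (L2C_fun x t * cis t ^+ n))).
  by congr cintegral; apply/funext => t; rewrite mulrA.
apply: (@cintegral_dominated0 _ _ _ arc
  (fun m t => b ((r m)%:C * cis t) * (L2C_fun x t * cis t ^+ n)) _ _ _ _ (integrable_ReIm 1 iG)).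
- move=> m; apply: Lfun2C_integrable; apply: mul_Lfun2C; first exact: bounded_circle.
  by apply: Lfun2C_cisX; exact: L2C_fun_in.
- by apply: cmeasurableM => //; exact: cintegrable_measurable iG.
- by apply: filterS lim => t [c1 c2]; apply: mulr_ccvg.
- apply: aeW => t m; have h := circle_cabs_le1 t (r01 m).
  by split; [apply: ReM_le|apply: ImM_le].
- by move=> m; apply: cintegral_circle.
Qed.

(** If no function has the property that defines the boundary function, the latter
    is zero by convention. *)
Lemma analytic_boundary : analytic_symbol (boundary b).
Proof.
rewrite /boundary; case: xgetP => [phi _ [mphi radial]|_].
  exact: radial_symbol.
exact: analytic0.
Qed.

End Boundary.

(** * Irreducibility *)

(** This covers the default value of [op_sqrt]. *)
Lemma range_zero_not_reducible (R : realType) (V : lmodType R[i]) (E : ipspace V) (X : V -> V) :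
  ~ reducible (range_space E (fun=> 0)) X.
Proof.
move=> [M [[[ME M0 _ _] _ _] Mn0 _]]; apply: Mn0; apply/seteqP; split=> [x|_ ->//].
by move=> /ME [y _ <-].
Qed.

Theorem theorem3p1 (R : realType) (b : R[i] -> R[i]) (hb : Hinf_ball b) :
  ~ reducible (deBrangesRovnyak b) (Xb b).
Proof.
have anb := analytic_boundary hb; have [ubb _] := anb.
have anc := analytic_cis R.
rewrite /Xb /deBrangesRovnyak /op_sqrt.
case: xgetP => [A _ [posA sqrA]|_]; last exact: range_zero_not_reducible.
apply: (@restr_not_reducible R _ (H2 R) (toeplitz (@cis R)) (@backward_shift R)
  (toeplitz (boundary b)) (toeplitz (fun t => (boundary b t)^*%C)) A (cis_class R 0)).
- exact: H2_hilbert.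
- by move=> x _; exact: toeplitz_car.
- by move=> x _; exact: toeplitz_car.
- by move=> x _; exact: toeplitz_car.
- by move=> x _; exact: toeplitz_car.
- by move=> x y hx hy; apply: toeplitz_adj => //; exact: bounded_cis.
- by move=> x y hx hy; exact: toeplitz_adj.
- exact: backward_shift_shift.
- exact: cis_class_H2.
- exact: one_norm.
- exact: wold_decomposition.
- by move=> x hx; exact: toeplitz_analytic_shift.
- exact: shift_total.
- exact: posA.
- exact: sqrA.
- by move=> x hx; rewrite /patch ifT// inE.
Qed.
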